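(* Let $G$ be a graph with odd girth at least $11$ and let $X\subseteq V(G)$ satisfy $\chi(G[X])\ge 99525$. Then $G$ contains a $5$-arithmetic rope all of whose vertices lie in $X$; that is, there are vertices $q_1,\dots,q_5\in X$ and paths $Q_{i,1},Q_{i,2}$ ($1\le i\le 5$) in $G[X]$ such that, with indices modulo $5$: for each $i$, $Q_{i,1}$ is a path of odd length and $Q_{i,2}$ a path of even length between $q_i$ and $q_{i+1}$; for every $(h_1,\dots,h_5)\in\{1,2\}^5$, $Q_{1,h_1}\cup\cdots\cup Q_{5,h_5}$ is an induced cycle of $G$; and $q_1,\dots,q_5$ are pairwise at distance at least $5$ in $G$.
   Context: All graphs are finite and simple. The odd girth of a graph is the length of a shortest odd cycle. $\chi(G[X])$ is the chromatic number of the subgraph induced by $X$. Length of a path is its number of edges. *)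

(* Defs.v *)
From mathcomp Require Import all_boot.

Set Implicit Arguments.
Unset Strict Implicit.
Unset Printing Implicit Defensive.

Record sgraph := SGraph {
  svertex :> finType;
  sedge : rel svertex;
  sedge_sym : symmetric sedge;
  sedge_irr : irreflexive sedge
}.

Notation "x -- y" := (sedge x y) (at level 30).

Section Induced.
Variables (G : sgraph) (X : {set G}).

Definition induced_edge : rel {x : G | x \in X} := fun x y => val x -- val y.

Fact induced_sym : symmetric induced_edge.
Proof. by move=> x y; exact: sedge_sym. Qed.

Fact induced_irr : irreflexive induced_edge.
Proof. by move=> x; exact: sedge_irr. Qed.

Definition induced : sgraph := SGraph induced_sym induced_irr.

End Induced.

Section ChromaticNumber.
Variable G : sgraph.

Definition colorable (k : nat) : bool :=
  [exists f : {ffun G -> 'I_k}, [forall x, forall y, x -- y ==> (f x != f y)]].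

Fact colorable_ex : exists k, colorable k.
Proof.
exists #|G|; apply/existsP; exists [ffun x => enum_rank x].
apply/forallP => x; apply/forallP => y; apply/implyP => xy.
rewrite !ffunE; apply/eqP => /enum_rank_inj E.
by rewrite E sedge_irr in xy.
Qed.

Definition chi : nat := ex_minn colorable_ex.

End ChromaticNumber.

Section PathsAndCycles.
Variable G : sgraph.
Implicit Types (x y : G) (p c : seq G) (V : {set G}) (E : {set {set G}}).

(* As in path.v, a path starting at x is given by the sequence p of its other
   vertices, so that its length (number of edges) is size p. *)
Definition gpath x y p : bool :=
  [&& path (@sedge G) x p, last x p == y & uniq (x :: p)].

Definition path_vertices x p : {set G} := [set z in x :: p].

Definition path_edges x p : {set {set G}} :=
  [set [set uv.1; uv.2] | uv in zip (x :: p) p].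

(* The length of the cycle c is size c. *)
Definition gcycle c : bool := [&& 2 < size c, uniq c & cycle (@sedge G) c].

Definition cycle_edges c : {set {set G}} := [set [set u; next c u] | u in c].

Definition edges : {set {set G}} :=
  [set [set uv.1; uv.2] | uv : G * G & uv.1 -- uv.2].

(* The subgraph with vertex set V and edge set E is an induced cycle of G. *)
Definition induced_cycle V E : Prop :=
  (exists c, [/\ gcycle c, V = [set x in c] & E = cycle_edges c]) /\
  E = [set f in edges | f \subset V].

(* The distance is infinite if x and y are in different components. *)
Definition distance_ge (d : nat) x y : Prop :=
  forall p, gpath x y p -> d <= size p.

(* The odd girth is infinite if there is no odd cycle. *)
Definition odd_girth_ge (g : nat) : Prop :=
  forall c, gcycle c -> odd (size c) -> g <= size c.

End PathsAndCycles.

(* Q i true and Q i false are the odd path Q_{i,1} and the even path Q_{i,2}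
   from q i to its cyclic successor q (ordS i); d is the lower bound on the
   pairwise distances between the q i. *)
Definition arithmetic_rope (G : sgraph) (k d : nat)
    (q : 'I_k -> G) (Q : 'I_k -> bool -> seq G) : Prop :=
  [/\ forall i h, gpath (q i) (q (ordS i)) (Q i h),
      forall i, odd (size (Q i true)) /\ ~~ odd (size (Q i false)),
      forall h : 'I_k -> bool,
        induced_cycle (\bigcup_i path_vertices (q i) (Q i (h i)))
                      (\bigcup_i path_edges (q i) (Q i (h i)))
    & forall i j, i != j -> distance_ge d (q i) (q j)].

(* Main.v *)
(** Balls of radius 4 of G have bounded chromatic number, because each sphere of
radius at most 4 is stable, so bounded sets can be discarded with their balls.

In a breadth-first search of G[X] some level has large chromatic number; let D
be a component of it of large chromatic number, B and Y the two levels above it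
and A the (connected) union of the levels above Y. The rope is built inside D,
using a few vertices of B, and is closed at the end through B, Y and A. At each
moment a connected set C of large chromatic number remains in which only the end
s of the rope built so far has neighbours, and such that the vertices of B
adjacent to C, and the vertices of Y adjacent to these, have no neighbour in that
part of the rope, up to bounded balls.

One step goes as follows. Search C from s and take a level j of large chromatic
number. A vertex x of this level has a canonical induced path from s: a geodesic
to the first vertex p (level by level) that is adjacent to x, or that lies below
level j - 1 and has a common neighbour b in B with x, followed by b in the
second case. Rank x by p and keep only vertices whose canonical paths have the
same parity. Some edge uv and some connected set Z of large chromatic number
exist such that u, v rank before Z and one of them has a neighbour in Z. By the
choice of p, no vertex of Z is adjacent to the canonical paths of u and v, nor
has a common neighbour in B with them, except near their ends. After removing
the neighbours of u and v from Z, a component C' is reached through a vertex r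
adjacent to, say, v; the canonical path of v followed by r and that of u
followed by v, r are the two paths, and r is the new end of the rope. *)

Require Import Defs.
From mathcomp Require Import all_boot zify.

Set Implicit Arguments.
Unset Strict Implicit.
Unset Printing Implicit Defensive.

Section Graph.
Variable G : sgraph.
Implicit Types (x y z u v w s : G) (l : seq G) (A C D S T Z : {set G}).

Local Notation E := (@sedge G).

(** * Induced paths *)

Fixpoint ipath l : bool :=
  if l is x :: l' then
    ipath l' &&
    (if l' is y :: l'' then x -- y && all (fun z => (z != x) && ~~ x -- z) l''
     else true)
  else true.

Lemma edge_neq x y : x -- y -> x != y.
Proof. by move=> xy; apply: contraTneq xy => ->; rewrite sedge_irr. Qed.

Lemma ipath_path x p : ipath (x :: p) -> path E x p.
Proof. by elim: p x => //= y p IH x /andP[/IH -> /andP[-> _]]. Qed.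

Lemma ipath_uniq l : ipath l -> uniq l.
Proof.
elim: l => //= x [|y l] IH // /andP[il /andP[xy /allP al]].
rewrite (IH il) andbT inE (negPf (edge_neq xy)) /=.
by apply/negP => /al; rewrite eqxx.
Qed.

Lemma ipath_suffix l1 l2 : ipath (l1 ++ l2) -> ipath l2.
Proof. by elim: l1 => //= x l1 IH /andP[/IH]. Qed.

(** Both sides contain [x], so a chord or repetition they do not already exclude joins [l1] to
    [l2]. *)
Lemma ipath_cat l1 x l2 :
  ipath (rcons l1 x) -> ipath (x :: l2) ->
  {in l1 & l2, forall u v, u != v /\ ~~ u -- v} -> ipath (l1 ++ x :: l2).
Proof.
elim: l1 => // y l1 IH i1 i2 H.
have {}IH : ipath (l1 ++ x :: l2).
  apply: IH => //; first by move: i1 => /= /andP[].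
  by move=> u v ul vl; apply: H => //; rewrite inE ul orbT.
have Hy v : v \in l2 -> (v != y) && ~~ y -- v.
  by move=> vl; have [] := H y v (mem_head _ _) vl; rewrite eq_sym => -> ->.
case: l1 {H} i1 IH => [|z l1] i1 IH.
  move: i1 => /= /andP[yx _]; change (ipath (x :: l2) && (y -- x && all (fun z => (z != y) && ~~ y -- z) l2)).
  by rewrite i2 yx; apply/allP.
change (ipath ((z :: l1) ++ x :: l2) && (y -- z && all (fun z => (z != y) && ~~ y -- z) (l1 ++ x :: l2))).
rewrite IH /=; case/andP: i1 => _ /andP[-> /allP al] /=.
apply/allP => w; rewrite mem_cat => /orP[wl|].
  by apply: al; rewrite mem_rcons inE wl orbT.
by rewrite inE => /predU1P[->|/Hy//]; apply: al; rewrite mem_rcons mem_head.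
Qed.

Lemma ipath_rcons x p y :
  ipath (x :: p) -> last x p -- y ->
  {in x :: p, forall w, w != last x p -> w != y /\ ~~ w -- y} ->
  ipath (x :: rcons p y).
Proof.
move=> ip ey H.
have ul := ipath_uniq ip; move: ip ul H; rewrite lastI => ip ul H.
rewrite -rcons_cons lastI -cats1 cat_rcons; apply: ipath_cat => //=.
  by rewrite ey.
move=> u v ub; rewrite inE => /eqP->; apply: H; first by rewrite mem_rcons inE ub orbT.
by apply: contraTneq ub => ->; move: ul; rewrite rcons_uniq => /andP[].
Qed.

(** The first of the two vertices heads an induced suffix, and a head is adjacent to its successor
    only. *)
Lemma ipath_adj l u v : ipath l -> u \in l -> v \in l -> u -- v ->
  exists l1 l2, l = l1 ++ u :: v :: l2 \/ l = l1 ++ v :: u :: l2.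
Proof.
have main x l' w : ipath (x :: l') -> w \in l' -> x -- w ->
    exists l2, x :: l' = x :: w :: l2.
  case: l' => //= y l' /andP[_ /andP[_ /allP al]].
  by rewrite inE => /predU1P[-> _|/al/andP[_ /negPf->]//]; exists l'.
elim: l => // x l IH il; rewrite !inE.
move=> /predU1P[->|ul] /predU1P[->|vl] uv.
- by rewrite sedge_irr in uv.
- by have [l2 ->] := main _ _ _ il vl uv; exists [::], l2; left.
- rewrite sedge_sym in uv; have [l2 ->] := main _ _ _ il ul uv.
  by exists [::], l2; right.
have [|l1 [l2 [->|->]]] := IH _ ul vl uv; first by case/andP: il.
  by exists (x :: l1), l2; left.
by exists (x :: l1), l2; right.
Qed.

(** * Connected sets and breadth-first search *)

Definition within A : rel G := fun x y => [&& x \in A, y \in A & x -- y].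

Lemma within_sym A : connect_sym (within A).
Proof.
by apply: sym_connect_sym => x y; rewrite /within andbCA sedge_sym.
Qed.

Definition connected A := [forall x in A, forall y in A, connect (within A) x y].

Lemma connectedP A :
  reflect {in A &, forall x y, connect (within A) x y} (connected A).
Proof.
apply: (iffP idP) => [/forall_inP H x y xA yA|H].
  by have /forall_inP := H x xA; apply.
by apply/forall_inP => x xA; apply/forall_inP => y yA; exact: H.
Qed.

Lemma within_mono A Z : A \subset Z -> subrel (connect (within A)) (connect (within Z)).
Proof.
move=> /subsetP AZ; apply: connect_sub => x y /and3P[xA yA xy].
by apply: connect1; rewrite /within !AZ.
Qed.

Lemma connected1 x : connected [set x].
Proof. by apply/connectedP => y z; rewrite !inE => /eqP-> /eqP->. Qed.

Lemma connectedU A Z x y : connected A -> connected Z ->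
  x \in A -> y \in Z -> x -- y -> connected (A :|: Z).
Proof.
move=> /connectedP cA /connectedP cZ xA yZ xy.
have xyc : connect (within (A :|: Z)) x y.
  by apply: connect1; rewrite /within !inE xA yZ orbT.
have toX u : u \in A :|: Z -> connect (within (A :|: Z)) x u.
  rewrite inE => /orP[uA|uZ].
    by apply: (within_mono (subsetUl _ _)); exact: cA.
  apply: connect_trans xyc _.
  by apply: (within_mono (subsetUr _ _)); exact: cZ.
apply/connectedP => u v /toX xu /toX; apply: connect_trans.
by rewrite within_sym.
Qed.

Lemma connectedU1 x y Z : connected Z -> y \in Z -> x -- y -> connected (x |: Z).
Proof. by move=> cZ yZ; apply: connectedU => //; rewrite ?connected1 ?set11. Qed.

(** The edge is where a walk in [D] from [y] to [x] first leaves [C]. *)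
Lemma connected_boundary D C x y : connected D -> C \subset D ->
  y \in C -> x \in D -> x \notin C ->
  exists u v, [/\ u \in D, u \notin C, v \in C & u -- v].
Proof.
move=> /connectedP cD /subsetP CD yC xD xC.
have /connectP[p pp ex] := cD _ _ (CD _ yC) xD.
elim: p y yC pp ex => [|z p IH] y yC /= ; first by move=> _ ex; rewrite ex yC in xC.
case/andP=> /and3P[yD zD yz] pp ex; have [zC|zC] := boolP (z \in C).
  exact: IH zC pp ex.
by exists z, y; rewrite sedge_sym.
Qed.

Lemma bfs_levels A s : connected A -> s \in A -> exists lev : G -> nat,
  [/\ lev s = 0, {in A, forall x, lev x = 0 -> x = s},
      {in A &, forall x y, x -- y -> lev y <= (lev x).+1}
    & {in A, forall x, 0 < lev x ->
        exists y, [/\ y \in A, y -- x & lev x = (lev y).+1]}].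
Proof.
move=> /connectedP cA sA.
(* The first disjunct makes the minimum exist for every [x]; vertices not reachable within [A] get
   the default level 0. *)
pose P x n := ~~ connect (within A) s x ||
  [exists t : n.-tuple G, path (within A) s t && (last s t == x)].
have exP x : exists n, P x n.
  rewrite /P; case: (boolP (connect _ _ _)) => [/connectP[p pp ->]|_] /=.
    by exists (size p); apply/existsP; exists (in_tuple p); rewrite pp eqxx.
  by exists 0.
pose lev x := ex_minn (exP x); exists lev.
have levP x : x \in A -> exists2 p, path (within A) s p /\ last s p = x & size p = lev x.
  move=> xA; rewrite /lev; case: ex_minnP => n; rewrite /P cA //=.
  by case/existsP=> t /andP[pt /eqP lt] _; exists t; rewrite ?size_tuple.
have lev_min x p : path (within A) s p -> last s p = x -> lev x <= size p.
  move=> pp lp; rewrite /lev; case: ex_minnP => n _; apply.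
  by apply/orP; right; apply/existsP; exists (in_tuple p); rewrite pp lp eqxx.
split.
- by apply/eqP; rewrite -leqn0; apply: (lev_min s [::]).
- by move=> x xA; have [p [pp <-] <-] := levP x xA => /size0nil->.
- move=> x y xA yA xy; have [p [pp lp] <-] := levP x xA.
  rewrite -(size_rcons p y); apply: lev_min; last by rewrite last_rcons.
  by rewrite rcons_path pp lp /within xA yA xy.
move=> x xA x0; have [p] := levP x xA.
case/lastP: p => [|p y]; first by move=> _ sz; rewrite -sz in x0.
rewrite last_rcons rcons_path size_rcons => -[/andP[pp /and3P[lA _ ly]] yx] sz.
exists (last s p); rewrite -yx; split=> //; rewrite yx.
have [p' [pp' lp'] sz'] := levP _ lA.
apply/eqP; rewrite eqn_leq; apply/andP; split.
  rewrite -sz' -(size_rcons p' y); apply: lev_min; last by rewrite last_rcons.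
  by rewrite rcons_path pp' lp' /within lA yx xA -yx ly.
by rewrite -sz ltnS lev_min.
Qed.

(** Predecessors are followed down to [s]. The path is induced because an edge changes the level by
    at most one, while vertices that are not consecutive on it differ by at least two. *)
Lemma level_path A s (lev : G -> nat) :
  s \in A -> {in A, forall x, lev x = 0 -> x = s} ->
  {in A &, forall x y, x -- y -> lev y <= (lev x).+1} ->
  {in A, forall x, 0 < lev x ->
        exists y, [/\ y \in A, y -- x & lev x = (lev y).+1]} ->
  forall x, x \in A -> exists p,
    [/\ ipath (s :: p), last s p = x, {subset s :: p <= A}
      & {in s :: p, forall w, w != x -> lev w < lev x}].
Proof.
move=> sA l0 l1 lp x; move en: (lev x) => n; elim: n x en => [|n IH] x en xA.
  rewrite (l0 x xA en); exists [::]; split=> // w; rewrite inE => /eqP-> //.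
  by rewrite eqxx.
have [|y [yA yx ey]] := lp x xA; first by rewrite en.
have eny : lev y = n by move: ey; rewrite en => -[].
have [p [ip lasty sub lt]] := IH y eny yA.
have lt' w : w \in s :: p -> lev w <= n.
  by move=> ws; have [->|/(lt w ws)/ltnW//] := eqVneq w y; rewrite eny.
exists (rcons p x); split.
- apply: ipath_rcons => //; first by rewrite lasty.
  rewrite lasty => w ws wy; have lw := lt w ws wy; split.
    by apply: contraTneq lw => ->; rewrite en; lia.
  by apply: contraTN lw => /(l1 _ _ (sub _ ws) xA); rewrite en -leqNgt; lia.
- by rewrite last_rcons.
- move=> w; rewrite -rcons_cons mem_rcons inE => /predU1P[->//|]; exact: sub.
move=> w; rewrite -rcons_cons mem_rcons inE => /predU1P[->|/lt' h _]; last by rewrite ltnS.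
by rewrite eqxx.
Qed.

Lemma connected_ipath A s x : connected A -> s \in A -> x \in A ->
  exists p, [/\ ipath (s :: p), last s p = x & {subset s :: p <= A}].
Proof.
move=> cA sA xA; have [lev [_ l0 l1 lp]] := bfs_levels cA sA.
by have [p [? ? ? _]] := level_path sA l0 l1 lp xA; exists p.
Qed.

(** * Colourings of vertex sets *)

(** Colourings are total on [G] and constrained on [S] only. The spare colour keeps the type
    inhabited when [m = 0]. *)
Definition col m S := [exists f : {ffun G -> 'I_m.+1},
  [forall x in S, (f x < m) && [forall y in S, x -- y ==> (f x != f y)]]].

Lemma colP m S : reflect (exists f : G -> nat, {in S, forall x, f x < m} /\
    {in S &, forall x y, x -- y -> f x != f y}) (col m S).
Proof.
apply: (iffP existsP) => [[f /forall_inP H]|[f [fm fp]]].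
  exists (fun x => nat_of_ord (f x)); split=> [x /H/andP[]//|x y /H/andP[_ /forall_inP H'] yS xy].
  by have := implyP (H' y yS) xy.
pose F : {ffun G -> 'I_m.+1} := [ffun x => inord (f x)].
have vS y : y \in S -> F y = f y :> nat.
  by move=> yS; rewrite ffunE inordK // ltnS ltnW ?fm.
exists F; apply/forall_inP => x xS.
rewrite vS // fm //=; apply/forall_inP => y yS; apply/implyP => xy.
by rewrite -val_eqE /= !vS // fp.
Qed.

Lemma col_sub m S T : S \subset T -> col m T -> col m S.
Proof.
move=> /subsetP ST /colP[f [fm fp]]; apply/colP; exists f.
by split=> [x /ST/fm|x y /ST xT /ST yT]; last exact: fp.
Qed.

Lemma colU m n S T : col m S -> col n T -> col (m + n) (S :|: T).
Proof.
move=> /colP[f [fm fp]] /colP[g [gm gp]]; apply/colP.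
exists (fun x => if x \in S then f x else m + g x); split.
  move=> x; rewrite inE; case: ifP => /= [/fm + _|_ /gm]; lia.
move=> x y; rewrite !inE; case: ifP => xS; case: ifP => yS /= xT yT xy.
- exact: fp.
- have := fm _ xS; lia.
- have := fm _ yS; lia.
by rewrite eqn_add2l gp.
Qed.

Lemma col_leq m n S : m <= n -> col m S -> col n S.
Proof.
move=> mn /colP[f [fm fp]]; apply/colP; exists f; split=> // x /fm fx.
exact: leq_trans fx mn.
Qed.

Lemma col_stable S : {in S &, forall x y, ~~ x -- y} -> col 1 S.
Proof.
move=> H; apply/colP; exists (fun=> 0); split=> // x y xS yS.
by rewrite (negPf (H _ _ xS yS)).
Qed.

Lemma ncol_edge S : ~~ col 1 S -> exists x y, [/\ x \in S, y \in S & x -- y].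
Proof.
move=> nS; have: ~~ [forall x in S, forall y in S, ~~ x -- y].
  apply: contra nS => /forall_inP H; apply: col_stable => x y xS yS.
  by have /forall_inP := H x xS; apply.
rewrite negb_forall_in => /exists_inP[x xS].
rewrite negb_forall_in => /exists_inP[y yS /negPn xy].
by exists x, y.
Qed.

Lemma ncol_nonempty m S : ~~ col m S -> exists x, x \in S.
Proof.
have [->|/set0Pn//] := eqVneq S set0.
case/negP; apply/colP; exists (fun=> 0).
by split=> x; rewrite inE.
Qed.

Lemma ncolD m n S T : col n T -> ~~ col (m + n) S -> ~~ col m (S :\: T).
Proof.
move=> cT; apply: contra => /colU/(_ cT); apply: col_sub.
by apply/subsetP => x xS; rewrite !inE xS andbT orNb.
Qed.

Lemma ncol_split m n S T : ~~ col (m + n) S ->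
  ~~ col m (S :&: T) \/ ~~ col n (S :\: T).
Proof.
move=> nS; have [c|] := boolP (col m (S :&: T)); last by left.
right; apply: contra nS => c'; rewrite -(setID S T); exact: colU.
Qed.

(** No edge of [S] joins two fibres of [t], so all fibres can reuse the same [m] colours. *)
Lemma col_fibres (I : finType) (t : G -> I) m S :
  {in S &, forall x y, x -- y -> t x = t y} ->
  (forall i, col m [set x in S | t x == i]) -> col m S.
Proof.
move=> te H.
have /fin_all_exists[f fP] i : exists f : G -> nat,
    {in [set x in S | t x == i], forall x, f x < m} /\
    {in [set x in S | t x == i] &, forall x y, x -- y -> f x != f y}.
  exact/colP.
have St x : x \in S -> x \in [set y in S | t y == t x] by move=> xS; rewrite inE xS eqxx.
apply/colP; exists (fun x => f (t x) x); split=> [x xS|x y xS yS xy].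
  by apply: (proj1 (fP (t x))); exact: St.
have txy := te x y xS yS xy; rewrite -txy.
by apply: (proj2 (fP (t x))) => //; rewrite inE ?xS ?yS ?txy eqxx.
Qed.

Lemma ncol_component m S : ~~ col m S -> exists C,
  [/\ C \subset S, connected C, ~~ col m C
    & {in S & C, forall x y, x -- y -> x \in C}].
Proof.
(* [t x] is the component of [x], so the fibres of [t] on [S] are the components. *)
move=> nS; pose t x := [set y in S | connect (within S) x y].
have [i ni] : exists i, ~~ col m [set x in S | t x == i].
  apply/existsP; apply: contraNT nS; rewrite negb_exists => /forallP H.
  apply: (col_fibres (t := t)) => [x y xS yS xy|i]; last by move/negPn: (H i).
  apply/setP => z; rewrite !inE (same_connect (@within_sym S) (y := y)) //.
  by apply: connect1; rewrite /within xS yS.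
have [w] := ncol_nonempty ni; rewrite inE => /andP[wS /eqP tw].
have mem x : (x \in [set x in S | t x == i]) = (x \in S) && connect (within S) w x.
  rewrite inE; case xS: (x \in S) => //=; rewrite -tw; apply/eqP/idP => [txw|cwx].
    have: x \in t x by rewrite inE xS connect0.
    by rewrite txw inE xS.
  by apply/setP => z; rewrite !inE (same_connect (@within_sym S) cwx).
exists [set x in S | t x == i]; split=> //.
- by apply/subsetP => x; rewrite inE => /andP[].
- suff cw x : x \in [set x in S | t x == i] ->
      connect (within [set x in S | t x == i]) w x.
    apply/connectedP => x y /cw wx /cw; apply: connect_trans.
    by rewrite within_sym.
  rewrite mem => /andP[xS /connectP[p pp ->]] {x xS}.
  have: w \in [set x in S | t x == i] by rewrite mem wS connect0.
  elim: p w {mem tw wS} pp => [|y p IH] w //= /andP[/and3P[wS yS wy] pp] wC.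
  have yC : y \in [set x in S | t x == i].
    move: wC; rewrite !inE yS => /andP[_ /eqP <-]; apply/eqP/setP => z.
    rewrite !inE -(same_connect (@within_sym S) (x := w)) //.
    by apply: connect1; rewrite /within wS yS.
  apply: connect_trans (IH y pp yC); apply: connect1.
  by rewrite /within wC yC.
move=> x y xS; rewrite !mem xS => /andP[yS wy] xy /=.
by apply: connect_trans wy _; apply: connect1; rewrite /within xS yS sedge_sym.
Qed.

(** Among the vertices whose levels have one given parity, every edge stays inside a level. Choosing
    the parity costs the factor two. *)
Lemma ncol_level (lev : G -> nat) m S :
  {in S &, forall x y, x -- y -> lev y <= (lev x).+1} ->
  ~~ col (m + m) S -> exists j, ~~ col m [set x in S | lev x == j].
Proof.
move=> l1 nS; pose n := \max_x lev x.
have ln x : lev x < n.+1 by rewrite ltnS leq_bigmax.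
have main T : T \subset S -> {in T &, forall x y, odd (lev x) = odd (lev y)} ->
    ~~ col m T -> exists j, ~~ col m [set x in S | lev x == j].
  move=> TS To nT; pose t x := Ordinal (ln x).
  have [i ni] : exists i, ~~ col m [set x in T | t x == i].
    apply/existsP; apply: contraNT nT; rewrite negb_exists => /forallP H.
    apply: (col_fibres (t := t)) => [x y xT yT xy|i]; last by move/negPn: (H i).
    apply: val_inj => /=; have := To _ _ xT yT.
    have := l1 _ _ (subsetP TS _ xT) (subsetP TS _ yT) xy.
    rewrite sedge_sym in xy; have := l1 _ _ (subsetP TS _ yT) (subsetP TS _ xT) xy.
    lia.
  exists (val i); apply: contra ni; apply: col_sub; apply/subsetP => x.
  by rewrite !inE -val_eqE /= => /andP[/(subsetP TS) -> ->].
have [n1|n1] := ncol_split [set x | odd (lev x)] nS.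
  apply: main n1; first exact: subsetIl.
  by move=> x y; rewrite !inE => /andP[_ ->] /andP[_ ->].
apply: main n1; first exact: subsetDl.
by move=> x y; rewrite !inE => /andP[/negPf-> _] /andP[/negPf-> _].
Qed.

(** The vertices of [F] that admit no suitable [Z] can be coloured with [c + 1] colours, so some
    edge joins two vertices that admit one. *)
Lemma edge_before (g : G -> nat) c (F : {set G}) :
  {in F &, forall x y, g x = g y -> ~~ x -- y} -> ~~ col (c + 2) F ->
  exists u v (Z : {set G}), [/\ [/\ u \in F, v \in F & u -- v],
    Z \subset F, connected Z /\ ~~ col c Z,
    {in Z, forall x, g u < g x /\ g v < g x}
    & exists2 x, x \in Z & u -- x \/ v -- x].
Proof.
move=> gF nF.
pose good v (Z : {set G}) := [&& Z \subset F, connected Z, ~~ col c Z,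
   [forall x in Z, g v < g x] & [exists x in Z, v -- x]].
pose T := [set v | [exists Z : {set G}, good v Z]].
have cT : col c.+1 (F :\: T).
  apply: contraT => /ncol_component[K [KF cK nK _]].
  have [w wK] := ncol_nonempty nK.
  have [w0 w0K w0min] : exists2 w0, w0 \in K & {in K, forall x, g w0 <= g x}.
    by case: (arg_minnP g wK) => w0 ? H; exists w0.
  (* The vertices of least rank are stable, so some component [C] of the remainder of [K] is still
     not [c]-colourable. By maximality of [C], a vertex of [K] outside [C] with a neighbour in [C]
     has least rank, and [C] would put it in [T]. *)
  pose W := [set x | g x == g w0].
  have /ncol_component[C [CK cC nC maxC]] : ~~ col c (K :\: W).
    have [c1|//] := @ncol_split 1 c K W nK.
    case/negP: c1; apply: col_stable => x y; rewrite !inE => /andP[xK /eqP gx] /andP[yK /eqP gy].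
    apply: gF; last by rewrite gx gy.
      by have /subsetP/(_ _ xK) := KF; rewrite inE => /andP[].
    by have /subsetP/(_ _ yK) := KF; rewrite inE => /andP[].
  have [y yC] := ncol_nonempty nC.
  have CK' : C \subset K by apply: subset_trans CK (subsetDl _ _).
  have w0C : w0 \notin C.
    by apply/negP => /(subsetP CK); rewrite !inE eqxx.
  have [u [v [uK uC vC uv]]] := connected_boundary cK CK' yC w0K w0C.
  have gu : g u = g w0.
    apply/eqP/negPn/negP => gu; case/negP: uC; apply: (maxC u v) => //.
    by rewrite !inE gu.
  have := subsetP KF _ uK; rewrite !inE negb_exists => /andP[/forallP/(_ C)] + _.
  case/negP; apply/and5P; split=> //.
  - apply: subset_trans CK' (subset_trans KF (subsetDl _ _)).
  - apply/forall_inP => x xC; have := subsetP CK _ xC.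
    by rewrite !inE gu ltn_neqAle eq_sym => /andP[-> /w0min ->].
  - by apply/exists_inP; exists v.
have [|u [v [uF vF uv]]] := @ncol_edge (F :&: T).
  rewrite (_ : c + 2 = 1 + c.+1) in nF; last by lia.
  by have [//|] := ncol_split T nF; rewrite cT.
(* The set [Z] of the endpoint of larger rank comes after both endpoints. *)
wlog guv : u v uF vF uv / g u <= g v.
  move=> H; case: (leqP (g u) (g v)) => [|/ltnW] gg; first exact: (H u v).
  by apply: (H v u) => //; rewrite sedge_sym.
move: uF vF; rewrite !inE => /andP[uF _] /andP[vF /existsP[Z /and5P[ZF cZ nZ /forall_inP gZ /exists_inP[x xZ vx]]]].
exists u, v, Z; split=> //; last by exists x => //; right.
by move=> y /gZ gy; split=> //; apply: leq_ltn_trans guv gy.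
Qed.

(** * Walks and balls *)

(** Exact lengths of walks replace distances: they add up and keep track of parity. *)
Fixpoint walks n v : {set G} :=
  if n is m.+1 then [set y | [exists x in walks m v, x -- y]] else [set v].

Lemma walksP n v x :
  reflect (exists p, [/\ path E v p, last v p = x & size p = n]) (x \in walks n v).
Proof.
elim: n x => [|n IH] x /=.
  rewrite inE; apply: (iffP eqP) => [->|[p [_ lp /size0nil ep]]].
    by exists [::].
  by rewrite -lp ep.
rewrite inE; apply: (iffP exists_inP) => [[y /IH[p [pp lp sp]] yx]|].
  by exists (rcons p x); rewrite rcons_path last_rcons size_rcons pp lp sp.
case; case/lastP => [|p y]; first by case.
rewrite rcons_path last_rcons size_rcons => -[/andP[pp ly] <- [sp]].
by exists (last v p) => //; apply/IH; exists p.
Qed.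

Lemma walksS n v x y : x \in walks n v -> x -- y -> y \in walks n.+1 v.
Proof. by move=> xn xy; rewrite inE; apply/exists_inP; exists x. Qed.

Lemma walks1 x y : x -- y -> y \in walks 1 x.
Proof. by apply: walksS; rewrite /= set11. Qed.

Lemma walksD n m v x y : x \in walks n v -> y \in walks m x -> y \in walks (n + m) v.
Proof.
move=> /walksP[p [pp lp sp]] /walksP[q [pq lq sq]]; apply/walksP.
by exists (p ++ q); rewrite cat_path last_cat size_cat pp lp pq lq sp sq.
Qed.

Lemma walks_sym n x y : y \in walks n x -> x \in walks n y.
Proof.
elim: n y => [|n IH] y; first by rewrite !inE eq_sym.
rewrite {1}inE => /exists_inP[z /IH xz zy].
rewrite -add1n; apply: walksD xz.
by rewrite inE; apply/exists_inP; exists y; rewrite ?set11 // sedge_sym.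
Qed.

Lemma odd_closed_walk x p : path E x p -> last x p = x -> odd (size p) ->
  exists c : seq G, [/\ gcycle c, odd (size c) & size c <= size p].
Proof.
move: {-1}(size p).+1 (ltnSn (size p)) => n.
elim: n x p => // n IH x p; rewrite ltnS => szn pp lp op.
(* As [last x p = x], the list [p] goes once round the walk, so without repetition it is a cycle;
   length 1 would be a loop. *)
have [up|/uniqPn] := boolP (uniq p).
  exists p; split=> //; apply/and3P; split=> //; last first.
    by case: p pp lp {szn op up} => //= y p /andP[xy pp] lp; rewrite rcons_path pp lp.
  case: p pp lp op {szn up} => [|y [|z [|]]] //= /andP[xy _] yx.
  by rewrite yx sedge_irr in xy.
move=> /(_ x)[i [j [ij jp eij]]].
(* The part of the walk between two visits of a vertex and the rest of the walk
   are closed walks, one of which has odd length. *)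
have {}jp : j < size p := jp.
pose p1 := take i.+1 p; pose p2 := take (j - i) (drop i.+1 p); pose p3 := drop j.+1 p.
have ep : p = p1 ++ p2 ++ p3.
  rewrite /p3 (_ : drop j.+1 p = drop (j - i) (drop i.+1 p)) ?cat_take_drop //.
  by rewrite drop_drop; congr drop; lia.
have s1 : size p1 = i.+1 by rewrite size_take; case: ltnP => //; lia.
have s2 : size p2 = j - i.
  by rewrite size_take size_drop; case: ltnP => //; lia.
have l1 : last x p1 = nth x p i by rewrite (last_nth x) s1 /= nth_take.
have l2 : last x (p1 ++ p2) = nth x p j.
  have -> : p1 ++ p2 = take j.+1 p.
    by rewrite [in RHS]ep catA take_size_cat // size_cat s1 s2; lia.
  rewrite (last_nth x) size_take; case: ltnP => H /=; first by rewrite nth_take.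
  by rewrite (_ : size p = j.+1) /= ?nth_take //; lia.
have sp : size p = size p1 + (size p2 + size p3) by rewrite {1}ep !size_cat.
move: pp lp; rewrite ep !cat_path !last_cat => /and3P[pp1 pp2 pp3] lp3.
have l12 : last (last x p1) p2 = last x p1 by rewrite -last_cat l2 l1.
rewrite l12 in pp3 lp3.
have [o2|e2] := boolP (odd (size p2)).
  have [|c [? ? sc]] := IH _ _ _ pp2 l12 o2; first by lia.
  by exists c; split=> //; rewrite !size_cat; lia.
have [||||c [? ? sc]] := IH x (p1 ++ p3).
- by rewrite size_cat; lia.
- by rewrite cat_path pp1.
- by rewrite last_cat.
- by move: op; rewrite sp size_cat !oddD (negPf e2).
by exists c; split=> //; move: sc; rewrite !size_cat; lia.
Qed.

(** * Stable spheres and balls *)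

Section OddGirth.
Hypothesis girth : odd_girth_ge G 11.

(** The edge would complete a closed walk of odd length [2 * n + 1], which is at most 9. *)
Lemma no_odd_walk n x y z : y \in walks n x -> z \in walks n x -> n <= 4 -> ~~ y -- z.
Proof.
move=> yn /walks_sym zn n4; apply/negP => yz.
have /walksP[p [pp lp sp]] := walksD (walksS yn yz) zn.
have op : odd (size p) by rewrite sp addSn /= addnn odd_double.
have [c [gc oc sc]] := odd_closed_walk pp lp op.
have := girth gc oc; lia.
Qed.

Lemma triangle_free x y z : x -- y -> x -- z -> ~~ y -- z.
Proof. by move=> xy xz; apply: (@no_odd_walk 1 x); rewrite ?walks1. Qed.

(** Radius 4 is where stability of [walks i v] is available, and a vertex outside is at distance at
    least 5, as the rope requires. *)
Definition ball v : {set G} := \bigcup_(i < 5) walks i v.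

Lemma in_ball i v x : i <= 4 -> x \in walks i v -> x \in ball v.
Proof. by move=> i4 xi; apply/bigcupP; exists (Ordinal (i4 : i < 5)). Qed.

Lemma col_walks i v : i <= 4 -> col 1 (walks i v).
Proof. by move=> i4; apply: col_stable => x y xi yi; exact: no_odd_walk xi yi i4. Qed.

Lemma col_ball v : col 5 (ball v).
Proof.
rewrite /ball !big_ord_recl big_ord0 setU0.
by do 4![apply: (@colU 1); first exact: col_walks]; exact: col_walks.
Qed.

Definition balls (U : seq G) : {set G} := \bigcup_(u <- U) ball u.

Lemma col_balls (U : seq G) : col (5 * size U) (balls U).
Proof.
rewrite /balls; elim: U => [|u U IH]; first by rewrite big_nil; apply/colP; exists (fun=> 0); split=> x; rewrite inE.
by rewrite big_cons mulnS; apply: colU => //; exact: col_ball.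
Qed.

(** * The two paths of a gadget *)

Section CanonicalPaths.
Variables (B C : {set G}) (s : G) (lev : G -> nat) (j : nat).
Local Notation A := (s |: C).
Implicit Types (p q : G).
Hypothesis sC : s \notin C.
Hypothesis AB : {in A, forall x, x \notin B}.
Hypothesis lev0 : {in A, forall x, lev x = 0 -> x = s}.
Hypothesis levS : {in A &, forall x y, x -- y -> lev y <= (lev x).+1}.
Hypothesis lev_pred : {in A, forall x, 0 < lev x ->
  exists y, [/\ y \in A, y -- x & lev x = (lev y).+1]}.

(* Common neighbours with level [j - 1] are not allowed: such a link would give a
   path of length [j + 1] with possible chords to other vertices of level [j]. *)
Definition linked x p := (p \in A) &&
  (((lev p).+1 == j) && p -- x ||
   ((lev p).+1 < j) && [exists b in B, (p -- b) && (b -- x)]).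

(* Breaking the ties inside a level makes the vertices with a given least link
   a stable set, see [canonical_stable]. *)
Definition key p := lev p * #|G| + enum_rank p.

Lemma key_lt p q : lev p < lev q -> key p < key q.
Proof.
move=> pq; apply: (@leq_trans ((lev p).+1 * #|G|)).
  by rewrite /key mulSn addnC ltn_add2r ltn_ord.
by apply: (leq_trans (leq_mul pq (leqnn _))); rewrite leq_addr.
Qed.

Lemma key_inj : injective key.
Proof.
move=> p q epq; have elev : lev p = lev q.
  by case: (ltngtP (lev p) (lev q)) => // /key_lt; rewrite epq ltnn.
move: epq; rewrite /key elev => /addnI /val_inj; exact: enum_rank_inj.
Qed.

(** [pi] lists the inner vertices of the path from [s] to [x]. The vertex before [x] is [last s pi],
    which is [s] when [pi] is empty; it is either the link [p] or a vertex of [B] between [p] and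
    [x]. *)
Record canonical x p (pi : seq G) : Prop := Canonical {
  can_linked : linked x p;
  can_min : forall p' : G, linked x p' -> key p <= key p';
  can_ipath : ipath (s :: rcons pi x);
  can_init : {in s :: pi, forall w, w != last s pi ->
    [/\ w \in A, (lev w).+1 < j & key w <= key p]};
  can_last : last s pi -- x /\
    (last s pi = p /\ (lev p).+1 = j \/
     [/\ last s pi \in B, p -- last s pi & (lev p).+1 < j])
}.

Lemma far_levels w x : w \in A -> x \in A -> (lev w).+1 < lev x -> w != x /\ ~~ w -- x.
Proof.
move=> wA xA lw; split; first by apply: contraTneq lw => ->; rewrite -leqNgt.
by apply: contraTN lw => /(levS wA xA); rewrite -leqNgt.
Qed.

Lemma canonical_exists x : x \in C -> lev x = j ->
  exists ppi : G * seq G, canonical x ppi.1 ppi.2.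
Proof.
move=> xC lx; have xA : x \in A by rewrite inE xC orbT.
(* The predecessor of [x] is a link, so a least link exists. *)
have [y [yA yx ly]] : exists y, [/\ y \in A, y -- x & lev x = (lev y).+1].
  apply: lev_pred => //; rewrite lt0n; apply: contraNneq sC => l0.
  by rewrite -(lev0 xA l0).
have ly' : linked x y by rewrite /linked yA yx -ly lx eqxx.
case: (arg_minnP key ly') => p lp pmin.
have pA : p \in A by case/andP: lp.
have [q [iq lq qA qlt]] := level_path (setU11 s C) lev0 levS lev_pred pA.
case/andP: (lp) => _ /orP[/andP[/eqP lpj px]|/andP[lpj /exists_inP[b bB /andP[pb bx]]]].
  exists (p, q); split => //=.
  - apply: ipath_rcons => //; rewrite lq // => w wq wp.
    by apply: far_levels (qA _ wq) xA _; rewrite lx -lpj !ltnS qlt.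
  - move=> w wq; rewrite lq => wp; have lt := qlt _ wq wp; split; first exact: qA.
      by rewrite -lpj ltnS.
    exact: ltnW (key_lt lt).
  by rewrite lq; split=> //; left.
have mem w : w \in s :: rcons q b -> w != b -> w \in s :: q.
  by rewrite -rcons_cons mem_rcons inE => /predU1P[->|//]; rewrite eqxx.
have lek w : w \in s :: q -> lev w <= lev p.
  by move=> wq; have [->//|/(qlt _ wq)/ltnW] := eqVneq w p.
exists (p, rcons q b); split => //=.
- apply: ipath_rcons => [||w wq]; rewrite ?last_rcons //; last move=> wb.
    apply: ipath_rcons => //; rewrite lq // => w wq wp; split.
      by apply: contraTneq bB => <-; apply: AB; exact: qA.
    (* An earlier vertex adjacent to [b] would be a link of [x] with smaller key. *)
    apply/negP => wb; have := key_lt (qlt _ wq wp); rewrite ltnNge => /negP; apply.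
    apply: pmin; rewrite /linked (qA _ wq) /=; apply/orP; right.
    rewrite (leq_ltn_trans _ lpj) ?ltnS ?lek //=.
    by apply/exists_inP; exists b => //; rewrite wb bx.
  have {}wq := mem w wq wb.
  by apply: far_levels (qA _ wq) xA _; rewrite lx (leq_ltn_trans _ lpj) ?ltnS ?lek.
- move=> w wq; rewrite last_rcons => wb; have {}wq := mem w wq wb.
  split; [exact: qA | by rewrite (leq_ltn_trans _ lpj) ?ltnS ?lek |].
  by have [->//|/(qlt _ wq)/key_lt/ltnW] := eqVneq w p.
by rewrite last_rcons; split=> //; right.
Qed.

(** All vertices of the path but the last are too low to be adjacent to [x]. If the last one were
    adjacent to [x], then [p] would be a link of [x] with key below the minimum [key p']. *)
Lemma canonical_later u p pi x (p' : G) pi' :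
  canonical u p pi -> canonical x p' pi' -> x \in C -> lev x = j -> key p < key p' ->
  {in s :: pi, forall w, w != x /\ ~~ w -- x}.
Proof.
move=> cu cx xC lx kk w wpi; have xA : x \in A by rewrite inE xC orbT.
have notlinked y : key y <= key p -> ~ linked x y.
  by move=> ky /(can_min cx)/(leq_trans kk); rewrite ltnNge ky.
have [->|wl] := eqVneq w (last s pi); last first.
  have [wA lw _] := can_init cu wpi wl.
  by apply: far_levels; rewrite ?lx.
have pA : p \in A by case/andP: (can_linked cu).
case: (can_last cu) => _ [[-> lp]|[lB plast lp]]; split.
- by apply/eqP => e; move: lp; rewrite e lx => /eqP; rewrite -[X in _ == X]addn0 -addn1 eqn_add2l.
- by apply/negP => px; apply: (notlinked p) => //; rewrite /linked pA px lp eqxx.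
- by apply: contraTneq lB => ->; exact: AB.
apply/negP => lx'; apply: (notlinked p) => //; rewrite /linked pA lp /=.
by apply/orP; right; apply/exists_inP; exists (last s pi) => //; rewrite plast.
Qed.

(** Levels exclude all but the last vertex; that one is a neighbour of [u], so an edge to [v] would
    form a triangle. *)
Lemma canonical_neighbour u p pi v :
  canonical u p pi -> v \in C -> lev v = j -> u -- v ->
  {in s :: pi, forall w, w != v /\ ~~ w -- v}.
Proof.
move=> cu vC lv uv w wpi; have vA : v \in A by rewrite inE vC orbT.
have [->|wl] := eqVneq w (last s pi); last first.
  have [wA lw _] := can_init cu wpi wl.
  by apply: far_levels; rewrite ?lv.
case: (can_last cu) => lu H; split; last first.
  by apply: (triangle_free (x := u)); rewrite // sedge_sym.
case: H => [[-> lp]|[lB _ _]]; first by apply/eqP => e; move: lp; rewrite e lv => /eqP; rewrite -[X in _ == X]addn0 -addn1 eqn_add2l.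
by apply: contraTneq lB => ->; exact: AB.
Qed.

(** The level of [p] decides whether both vertices are one or two steps from [p], so an edge would
    close a walk of length 3 or 5. This gives the stable rank classes that [edge_before] asks
    for. *)
Lemma canonical_stable x y p pi pi' :
  canonical x p pi -> canonical y p pi' -> ~~ x -- y.
Proof.
move=> cx cy; have [lx Hx] := can_last cx; have [ly Hy] := can_last cy.
case: Hx Hy => [[ex lp]|[_ px lp]] [[ey lp']|[_ py lp']].
- by rewrite ex in lx; rewrite ey in ly; exact: triangle_free lx ly.
- by rewrite lp ltnn in lp'.
- by rewrite lp' ltnn in lp.
by apply: (@no_odd_walk 2 p); [exact: walksS (walks1 px) lx | exact: walksS (walks1 py) ly |].
Qed.

(** A vertex before the last is low enough to be linked through [b]; adjacent to [b], it would be a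
    link of [x] ranked before [p']. *)
Lemma canonical_cover u p pi x (p' : G) pi' b :
  canonical u p pi -> canonical x p' pi' -> key p < key p' -> b \in B -> b -- x ->
  {in s :: pi, forall w, w != last s pi -> ~~ w -- b}.
Proof.
move=> cu cx kk bB bx w wpi wl; have [wA lw kw] := can_init cu wpi wl.
apply/negP => wb; have := can_min cx (p' := w); rewrite /linked wA lw /=.
have -> : [exists b in B, (w -- b) && (b -- x)].
  by apply/exists_inP; exists b => //; rewrite wb.
by rewrite orbT => /(_ isT) /(leq_trans kk); rewrite ltnNge kw.
Qed.

End CanonicalPaths.

(** * Construction of one gadget *)

Lemma col_neighbours u : col 1 [set x | u -- x].
Proof. by apply: col_stable => x y; rewrite !inE; exact: triangle_free. Qed.

Lemma in_balls U u i x : i <= 4 -> u \in U -> x \in walks i u -> x \in balls U.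
Proof. by move=> i4 uU /(in_ball i4) xu; rewrite /balls bigcup_seq; apply/bigcupP; exists u. Qed.

Lemma mem_cons_rcons s (p : seq G) x w :
  (w \in s :: rcons p x) = (w == x) || (w \in s :: p).
Proof. by rewrite -rcons_cons mem_rcons in_cons. Qed.

(** [Bad] will be the five balls left by the previous gadget, and [U] names the centres for the next
    one. Each path vertex in [B] has a neighbour in [C] outside [Bad], which keeps the older part of
    the rope away from it. *)
Lemma gadget (B D C Bad : {set G}) s m :
  connected C -> s \notin C -> (exists2 c, c \in C & s -- c) ->
  s |: C \subset D -> {in D, forall x, x \notin B} -> col 25 Bad ->
  ~~ col (4 * m + 66) C ->
  exists (Q : bool -> seq G) r (C' : {set G}) (U : seq G),
  [/\ forall h, [/\ ipath (s :: Q h), last s (Q h) = r & odd (size (Q h)) = h],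
      forall h, {in Q h, forall w,
        w \in C \/ w \in B /\ exists2 x, x \in C :\: Bad & w -- x},
      [/\ C' \subset C :\: Bad, connected C', ~~ col m C', r \in C :\: Bad
        & r \notin C' /\ exists2 c, c \in C' & r -- c],
      forall h, {in s :: Q h, forall w,
        w \notin C' /\ (w != r -> {in C', forall c, ~~ w -- c})}
    & [/\ size U = 5, r \in U, forall h, {in Q h, forall w, w \in B -> w \in U}
        & forall h, {in s :: Q h, forall w, {in B, forall b, {in C', forall c,
            c \notin balls U -> b -- c -> w != b /\ ~~ w -- b}}}]].
Proof.
move=> cC sC [c0 c0C sc0] AD DB cBad nC.
have cA : connected (s |: C) by apply: connectedU1 sc0.
have AB : {in s |: C, forall x, x \notin B} by move=> x /(subsetP AD); exact: DB.
have CA x : x \in C -> x \in s |: C by rewrite inE orbC => ->.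
have [lev [_ lev0 levS lev_pred]] := bfs_levels cA (setU11 s C).
(* The level costs a factor two, [Bad] costs 25, and the parity another factor two, leaving [m + 4]:
   2 colours for [edge_before] and 2 for the neighbours of [u] and [v]. *)
have [j nj] : exists j, ~~ col (2 * m + 8 + 25) [set x in C | lev x == j].
  apply: ncol_level => [x y /CA xA /CA yA|]; first exact: levS.
  by rewrite (_ : _ + _ = 4 * m + 66) //; lia.
have can x : exists d : G * seq G, x \in [set x in C | lev x == j] ->
    canonical B C s lev j x d.1 d.2.
  have [|_] := boolP (x \in _); last by exists (x, [::]).
  rewrite inE => /andP[xC /eqP lx].
  by have [d cd] := canonical_exists sC AB lev0 levS lev_pred xC lx; exists d.
have {can} [f fP] := fin_all_exists can.
have {nj} nF := ncolD cBad nj.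
have [F [FF [o oF] {}nF]] : exists F : {set G}, [/\ F \subset [set x in C | lev x == j] :\: Bad,
    exists o, {in F, forall x, odd (size (f x).2) = o} & ~~ col (m + 2 + 2) F].
  rewrite (_ : 2 * m + 8 = m + 2 + 2 + (m + 2 + 2)) in nF; last by lia.
  have [n1|n1] := ncol_split [set x | odd (size (f x).2)] nF.
    exists (([set x in C | lev x == j] :\: Bad) :&: [set x | odd (size (f x).2)]).
    split=> //; first exact: subsetIl.
    by exists true => x; rewrite !inE => /andP[].
  exists (([set x in C | lev x == j] :\: Bad) :\: [set x | odd (size (f x).2)]).
  split=> //; first exact: subsetDl.
  by exists false => x; rewrite !inE => /andP[/negPf].
have FP x : x \in F -> [/\ x \in C :\: Bad, x \in C, lev x = j & canonical B C s lev j x (f x).1 (f x).2].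
  move=> /(subsetP FF) xF; have xM : x \in [set x in C | lev x == j].
    by case/setDP: xF.
  split; last exact: fP.
  - by move: xF; rewrite !inE => /and3P[-> ->].
  - by move: xM; rewrite inE => /andP[].
  by move: xM; rewrite inE => /andP[_ /eqP].
pose g x := key lev (f x).1.
have [|u [v [Z [[uF vF uv] ZF [cZ nZ] gZ [x0 x0Z x0uv]]]]] := @edge_before g (m + 2) F _ nF.
  move=> x y xF yF /key_inj exy; have [_ _ _ cx] := FP x xF; have [_ _ _ cy] := FP y yF.
  by apply: canonical_stable cx _; rewrite exy; exact: cy.
pose N := [set x | u -- x] :|: [set x | v -- x].
have cN : col 2 N by apply: (@colU 1 1); exact: col_neighbours.
have [C' [C'Z cC' nC' maxC']] := ncol_component (ncolD cN nZ).
have [y0 y0C'] := ncol_nonempty nC'.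
have C'Z' : C' \subset Z by apply: subset_trans C'Z (subsetDl _ _).
have C'N : {in C', forall c, ~~ u -- c /\ ~~ v -- c}.
  by move=> c /(subsetP C'Z); rewrite !inE negb_or => /andP[/andP[]].
have x0C' : x0 \notin C'.
  by apply/negP => /C'N[nu nv]; case: x0uv => [xu|xv]; [rewrite xu in nu|rewrite xv in nv].
have [r [y [rZ rC' yC' ry]]] := connected_boundary cZ C'Z' y0C' x0Z x0C'.
(* Otherwise [r] would survive the removal of [N] and belong to the component [C']. *)
have rN : u -- r \/ v -- r.
  apply/orP/negPn/negP; rewrite negb_or => /andP[nu nv]; case/negP: rC'.
  by apply: (maxC' r y) => //; rewrite !inE (negPf nu) (negPf nv) rZ.
clear N cN C'Z maxC' x0uv.
wlog vr : u v uF vF uv gZ C'N rN / v -- r.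
  move=> H; case: (rN) => [ur|vr]; last exact: (H u v uF vF uv gZ C'N rN vr).
  apply: (H v u vF uF) => //.
  - by rewrite sedge_sym.
  - by move=> x /gZ[].
  - by move=> x /C'N[].
  by right.
have C'F c : c \in C' -> c \in F by move=> /(subsetP C'Z')/(subsetP ZF).
have rF : r \in F by exact: (subsetP ZF).
have [_ uC lu cu] := FP u uF; have [_ vC lv cv] := FP v vF.
have [rCB rC lr cr] := FP r rF.
have later w x : w \in F -> x \in Z -> g w < g x ->
    {in s :: (f w).2, forall a, a != x /\ ~~ a -- x}.
  move=> wF /(subsetP ZF) /FP[_ xC lx cx] gwx; have [_ _ _ cw] := FP w wF.
  exact (canonical_later AB levS cw cx xC lx gwx).
have ur : ~~ u -- r by apply: (triangle_free (x := v)); rewrite // sedge_sym.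
have iv1 : ipath (s :: rcons (rcons (f v).2 v) r).
  apply: ipath_rcons; rewrite ?last_rcons //; first exact: can_ipath cv.
  move=> w; rewrite mem_cons_rcons => /predU1P[->|ws _]; first by rewrite eqxx.
  by apply: (later v); rewrite ?(proj2 (gZ _ rZ)).
have iu1 : ipath (s :: rcons (rcons (f u).2 u) v).
  apply: ipath_rcons; rewrite ?last_rcons //; first exact: can_ipath cu.
  move=> w; rewrite mem_cons_rcons => /predU1P[->|ws _]; first by rewrite eqxx.
  exact (canonical_neighbour AB levS cu vC lv uv ws).
have iu2 : ipath (s :: rcons (rcons (rcons (f u).2 u) v) r).
  apply: ipath_rcons; rewrite ?last_rcons //.
  move=> w; rewrite !mem_cons_rcons => /or3P[/eqP->|/eqP-> _|ws _].
  - by rewrite eqxx.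
  - split=> //; apply: contraTneq (proj1 (gZ _ rZ)) => ->; by rewrite ltnn.
  by apply: (later u); rewrite ?(proj1 (gZ _ rZ)).
(* The inner parts have sizes of the same parity [o]; appending two vertices keeps it and appending
   three changes it. *)
pose Q h := if h == o then rcons (rcons (f v).2 v) r
            else rcons (rcons (rcons (f u).2 u) v) r.
have memQ h w : w \in s :: Q h ->
    [\/ exists2 t, t \in [:: u; v] & w \in s :: (f t).2, w = u \/ w = v | w = r].
  rewrite /Q; case: eqP => _; rewrite !mem_cons_rcons.
    case/or3P => [/eqP->|/eqP->|ws]; [by constructor 3|by constructor 2; right|].
    by constructor 1; exists v; rewrite // !inE eqxx orbT.
  case/or4P => [/eqP->|/eqP->|/eqP->|ws]; [by constructor 3|by constructor 2; right|by constructor 2; left|].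
  by constructor 1; exists u; rewrite // !inE eqxx.
have tF t : t \in [:: u; v] -> [/\ t \in F, {in Z, forall x, g t < g x} & t \in C :\: Bad].
  move=> tuv; have [->|->] : t = u \/ t = v.
  - by move: tuv; rewrite !inE => /orP[] /eqP; [left|right].
  - by have [] := FP u uF; split=> // x /gZ[].
  by have [] := FP v vF; split=> // x /gZ[].
(* The other path vertices lie in [s |: C], hence outside [B], and [canonical_cover] handles their
   neighbours in [B]. *)
exists Q, r, C', [:: last s (f u).2; last s (f v).2; u; v; r].
have lastU t : t \in [:: u; v] -> last s (f t).2 \in [:: last s (f u).2; last s (f v).2; u; v; r].
  by rewrite !inE => /orP[] /eqP->; rewrite eqxx ?orbT.
split.
- move=> h; rewrite /Q; case: eqP => [->|ho]; split=> //; rewrite ?last_rcons //.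
    by rewrite !size_rcons /= negbK; exact: oF.
  by rewrite !size_rcons /= negbK oF //; case: h o ho {oF Q memQ} => [] [].
- move=> h w wQ; have sw : w != s.
    have : uniq (s :: Q h) by apply: ipath_uniq; rewrite /Q; case: ifP.
    by case/andP => sQ _; apply: contraNneq sQ => <-.
  have [|[t tuv wt]|[->|->]|->] := memQ h w; rewrite ?inE ?wQ ?orbT //; try by left.
  have [tF' _ tC] := tF t tuv; have [_ _ _ ct] := FP t tF'.
  have inC a : a \in s |: C -> a != s -> a \in C.
    by rewrite !inE => /predU1P[->|//]; rewrite eqxx.
  have [ew|wl] := eqVneq w (last s (f t).2).
    case: (can_last ct) => wt' [[e _]|[wB _ _]]; rewrite -ew in wt' *.
      left; apply: inC => //; rewrite ew e; by case/andP: (can_linked ct).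
    by right; rewrite ew; split=> //; exists t; rewrite // -ew.
  by left; have [wA _ _] := can_init ct wt wl; exact: inC.
- split=> //; last by split=> //; exists y.
  by apply/subsetP => c /C'F /FP[].
- move=> h w wQ; have [[t tuv wt]|wuv|->] := memQ h w wQ; last by rewrite eqxx.
    have [tF' gt _] := tF t tuv.
    have lt c : c \in C' -> w != c /\ ~~ w -- c.
      by move=> /(subsetP C'Z') cZ'; apply: (later t) => //; exact: gt.
    split; last by move=> _ c /lt[].
    by apply/negP => /lt[]; rewrite eqxx.
  split; last by move=> _ c /C'N[]; case: wuv => ->.
  by apply/negP => /(subsetP C'Z')/gZ[]; case: wuv => ->; rewrite ltnn.
split=> //; first by rewrite !inE eqxx !orbT.
  move=> h w wQ wB; have [|[t tuv wt]|wuv|->] := memQ h w; rewrite ?inE ?wQ ?orbT //.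
  - have [tF' _ _] := tF t tuv; have [_ _ _ ct] := FP t tF'.
    have [->|wl] := eqVneq w (last s (f t).2); first by have := lastU t tuv; rewrite !inE.
    by have [/AB] := can_init ct wt wl; rewrite wB.
  - by case: wuv => ->; rewrite eqxx ?orbT.
  by rewrite eqxx ?orbT.
move=> h w wQ b bB c cC'' cU bc.
have inU : w \in [:: last s (f u).2; last s (f v).2; u; v; r] -> w != b /\ ~~ w -- b.
  move=> wU; split.
    apply: contraNneq cU => e; apply: (in_balls (i := 1) _ wU) => //.
    by rewrite e; exact: walks1.
  apply: contraNN cU => wb; apply: (in_balls (i := 2) _ wU) => //.
  exact: walksS (walks1 wb) bc.
have [[t tuv wt]|wuv|wr] := memQ h w wQ.
- have [tF' gt _] := tF t tuv; have [_ _ _ ct] := FP t tF'.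
  have [e|wl] := eqVneq w (last s (f t).2); first by apply: inU; rewrite e; exact: lastU.
  have [/AB wB _ _] := can_init ct wt wl; split.
    by apply: contraNneq wB => ->.
  have [_ _ _ cc] := FP c (C'F _ cC'').
  apply: (canonical_cover ct cc _ bB bc wt wl); apply: gt; exact: (subsetP C'Z').
- by apply: inU; rewrite !inE; case: wuv => ->; rewrite eqxx ?orbT.
by apply: inU; rewrite wr !inE eqxx !orbT.
Qed.

(** * Assembling the rope *)

Section Rope.
Variables (A Y B D : {set G}) (y0 b0 : G).
Hypothesis cA : connected A.
Hypothesis AB : {in A & B, forall x y, ~~ x -- y}.
Hypothesis AD : {in A & D, forall x y, ~~ x -- y}.
Hypothesis YD : {in Y & D, forall x y, ~~ x -- y}.
Hypothesis disjA : {in A, forall x, [/\ x \notin Y, x \notin B & x \notin D]}.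
Hypothesis disjYD : {in Y, forall x, x \notin D}.
Hypothesis disjDB : {in D, forall x, x \notin B}.
Hypothesis upY : {in Y, forall x, exists2 a, a \in A & x -- a}.
Hypothesis upB : {in B, forall x, exists2 y, y \in Y & x -- y}.
Hypothesis upD : {in D, forall x, exists2 b, b \in B & x -- b}.
Hypothesis y0Y : y0 \in Y.
Hypothesis b0B : b0 \in B.
Hypothesis b0y0 : b0 -- y0.

(** Each segment omits its starting vertex, so junctions are not repeated. *)
Fixpoint chain (Q : nat -> bool -> seq G) (h : nat -> bool) i : seq G :=
  if i is j.+1 then chain Q h j ++ Q j (h j) else [::].

Lemma mem_chain Q h i w : w \in chain Q h i -> exists2 j, j < i & w \in Q j (h j).
Proof.
elim: i => // i IH /=; rewrite mem_cat => /orP[/IH[j ji wj]|wi]; last by exists i.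
by exists j => //; exact: ltnW.
Qed.

Lemma eq_chain Q Q' h i : (forall j, j < i -> Q j =1 Q' j) -> chain Q h i = chain Q' h i.
Proof.
elim: i => //= i IH H; rewrite IH ?H // => j ji; exact: H (ltnW ji).
Qed.

(* The first [i] gadgets join [q 0] to [q i], and [S] contains their vertices
   and [y0], [b0]. The rest of the rope is looked for in [C]: only [q i] has
   neighbours there, and outside of the balls around the last vertices [U] the
   way up from [C] to [A] avoids the neighbours of [S]. *)
Record rope_prefix i m (q : nat -> G) (Q : nat -> bool -> seq G)
    (C S : {set G}) (U : seq G) : Prop := RopePrefix {
  rp_path : forall h, ipath (q 0 :: chain Q h i);
  rp_seg : forall j h, j < i ->
    [/\ ipath (q j :: Q j h), last (q j) (Q j h) = q j.+1 & odd (size (Q j h)) = h];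
  rp_sub : forall j h, j < i -> {subset Q j h <= S};
  rp_in : [/\ y0 \in S, b0 \in S, q 0 \in D & b0 -- q 0];
  rp_q : forall j, j <= i -> q j \in S;
  rp_S : {in S, forall w, [\/ w = y0, w \in B | w \in D]};
  rp_front : forall j h, j < i ->
    {in Q j h, forall w, [/\ w != y0, w != b0, ~~ w -- y0 & ~~ w -- b0]};
  rp_C : [/\ C \subset D, connected C & ~~ col m C];
  rp_CS : {in S & C, forall w c, w != c /\ (w != q i -> ~~ w -- c)};
  rp_end : q i \in D /\ exists2 c, c \in C & q i -- c;
  rp_clean : {in C, forall c, c \notin balls U -> {in B, forall b, b -- c ->
    {in S, forall w, (w != b /\ ~~ w -- b) /\
       {in Y, forall y, b -- y -> w != y /\ ~~ w -- y}}}};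
  rp_far : forall j, j < i -> {in C, forall c, c \notin ball (q j)} /\
    forall k, j < k -> k <= i -> q k \notin ball (q j);
  rp_U : size U = 5 /\ q i \in U
}.

Lemma rope_last i m q Q C S U h : rope_prefix i m q Q C S U ->
  last (q 0) (chain Q h i) = q i.
Proof.
move=> /rp_seg seg; elim: i seg => //= i IH seg.
rewrite last_cat IH => [|j h' ji]; last by apply: seg; exact: ltnW.
by have [] := seg i (h i) (ltnSn i).
Qed.

Lemma rope_mem_chain i m q Q C S U h : rope_prefix i m q Q C S U ->
  {subset q 0 :: chain Q h i <= S}.
Proof.
move=> st w; rewrite inE => /predU1P[->|]; first exact: rp_q st _ _.
by move/mem_chain => [j ji]; exact: (rp_sub st).
Qed.

Lemma rope_step i m q Q C S U : rope_prefix i (4 * m + 66) q Q C S U ->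
  exists q' Q' C' S' U', rope_prefix i.+1 m q' Q' C' S' U'.
Proof.
move=> st; have [CD cC nC] := rp_C st; have [sU5 siU] := rp_U st.
have [siD [c0 c0C sc0]] := rp_end st; have siS := rp_q st (leqnn i).
have [y0S b0S q0D b0q0] := rp_in st.
have sC : q i \notin C.
  by apply/negP => sC; have [] := rp_CS st siS sC; rewrite eqxx.
have sCD : q i |: C \subset D by rewrite subUset sub1set siD.
have cBad : col 25 (balls U) by have := col_balls U; rewrite sU5.
have [|P [r [C' [U' [Pp Pin [C'C cC' nC' rC [rC' [c1 c1C' rc1]]] PC' [sU' rU' BU' clean']]]]]] :=
  gadget cC sC _ sCD disjDB cBad nC; first by exists c0.
have C'sub c : c \in C' -> c \in C /\ c \notin balls U.
  by move=> /(subsetP C'C); rewrite inE => /andP[].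
have [rCC rU] : r \in C /\ r \notin balls U by move: rC; rewrite inE => /andP[].
(* New vertices in [C] are covered by [rp_CS]. Those in [B] have a neighbour in [C] outside
   [balls U], so [rp_clean] applies. *)
have new h : {in P h, forall v, {in S, forall w, w != q i -> w != v /\ ~~ w -- v}}.
  move=> v vP w wS ws; have [vC|[vB [x]]] := Pin h v vP.
    by have [? /(_ ws)] := rp_CS st wS vC.
  rewrite inE => /andP[xU xC] vx.
  by have [] := rp_clean st xC xU vB vx wS.
have neD x : x \in D -> (x != y0) * (x != b0).
  move=> xD; split; first by apply: contraTneq xD => ->; exact: disjYD.
  by apply: contraTneq b0B => <-; exact: disjDB.
have rP h : r \in P h.
  have [_ lr _] := Pp h; have := mem_last (q i) (P h).
  by rewrite lr inE => /predU1P[e|//]; rewrite -e rCC in sC.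
pose q' k := if k == i.+1 then r else q k.
pose Q' j := if j == i then P else Q j.
have q'E j : j <= i -> q' j = q j by rewrite /q' => ji; rewrite ltn_eqF.
have Q'E j : j < i -> Q' j = Q j by rewrite /Q' => ji; rewrite ltn_eqF.
have q'S : q' i.+1 = r by rewrite /q' eqxx.
have Q'i : Q' i = P by rewrite /Q' eqxx.
have Q'cases j h w : j < i.+1 -> w \in Q' j h -> j < i /\ w \in Q j h \/ w \in P h.
  rewrite ltnS leq_eqVlt => /predU1P[->|ji]; first by rewrite Q'i; right.
  by rewrite Q'E //; left.
have chE h : chain Q' h i.+1 = chain Q h i ++ P (h i).
  by rewrite /= Q'i; congr (_ ++ _); apply: eq_chain => j /Q'E->.
exists q', Q', C', (S :|: [set w in P true ++ P false]), U'.
have PS h w : w \in P h -> w \in S :|: [set w in P true ++ P false].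
  by move=> wP; rewrite !inE mem_cat; case: h wP => ->; rewrite !orbT.
have S'cases w : w \in S :|: [set w in P true ++ P false] ->
    w \in S \/ exists h, w \in P h.
  rewrite !inE mem_cat => /or3P[|wP|wP]; [by left|right; by exists true|right; by exists false].
split.
- move=> h; rewrite chE q'E //.
  have ip := rp_path st h; have := rope_mem_chain (h := h) st.
  have := ipath_uniq ip; move: ip; rewrite lastI (rope_last h st).
  set l1 := belast _ _ => il1 ul1 sub.
  rewrite -cat_cons lastI (rope_last h st) -/l1 cat_rcons.
  apply: ipath_cat => //; first by have [] := Pp (h i).
  move=> u v ul vP; apply: (new (h i) v vP u); first by apply: sub; rewrite mem_rcons inE ul orbT.
  by apply: contraTneq ul => ->; move: ul1; rewrite rcons_uniq => /andP[].
- move=> j h; rewrite ltnS leq_eqVlt => /predU1P[->|ji].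
    by rewrite Q'i q'E // q'S.
  by have ji' := ltnW ji; rewrite Q'E // !q'E //; exact: (rp_seg st).
- move=> j h ji w wQ'; have [[ji' wQ]|/PS//] := Q'cases j h w ji wQ'.
  by rewrite inE (rp_sub st ji' wQ).
- by rewrite q'E // !inE y0S b0S.
- move=> j; rewrite leq_eqVlt => /predU1P[->|ji]; first by rewrite q'S; exact: PS (rP true).
  by rewrite q'E // inE (rp_q st ji).
- move=> w /S'cases[/(rp_S st)//|[h /Pin[wC|[wB _]]]]; first by constructor 3; exact: (subsetP CD).
  by constructor 2.
- move=> j h ji w wQ'; have [[ji' wQ]|wP] := Q'cases j h w ji wQ'; first exact: (rp_front st ji' wQ).
  have [siy0 sib0] := neD _ siD; rewrite eq_sym in siy0; rewrite eq_sym in sib0.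
  have [y0w y0w'] := new h w wP y0 y0S siy0.
  have [b0w b0w'] := new h w wP b0 b0S sib0.
  by rewrite !(eq_sym w) !(sedge_sym w).
- by split=> //; apply/subsetP => c /C'sub[/(subsetP CD)].
- rewrite q'S => w c /S'cases[wS|[h wP]] cC''; last first.
    have [wC' H] : w \notin C' /\ (w != r -> {in C', forall c, ~~ w -- c}).
      by apply: (PC' h); rewrite inE wP orbT.
    by split; [apply: contraNneq wC' => -> | move=> /H/(_ c cC'')].
  have [cC1 _] := C'sub c cC''; have [wc H] := rp_CS st wS cC1; split=> //.
  have [->|/H//] := eqVneq w (q i); move=> sr.
  by have [_ ] := PC' true (q i) (mem_head _ _); apply.
- rewrite q'S; split; first exact: (subsetP CD).
  by exists c1.
- move=> c cC'' cU b bB bc w /S'cases[wS|[h wP]].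
    by have [cC1 cU1] := C'sub c cC''; exact: (rp_clean st cC1 cU1 bB bc wS).
  split; first by apply: (clean' h) bB c cC'' cU bc; rewrite inE wP orbT.
  (* A new vertex in [D] has no neighbour in [Y]. One in [B] belongs to [U'], and the walk through
     [y] and [b] would put [c] into its ball. *)
  move=> y yY yb; have [wC|[wB _]] := Pin h w wP.
    have wD := subsetP CD _ wC; split; last by rewrite sedge_sym YD.
    by apply: contraTneq wD => ->; exact: disjYD.
  have wU := BU' h w wP wB; split.
    apply: contraNneq cU => e; apply: (in_balls (i := 2) _ wU) => //.
    by rewrite e; apply: walksS bc; apply: walks1; rewrite sedge_sym.
  apply: contraNN cU => wy; apply: (in_balls (i := 3) _ wU) => //.
  by apply: walksS bc; apply: walksS (walks1 wy) _; rewrite sedge_sym.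
- move=> j; rewrite ltnS => ji; rewrite q'E //.
  (* For [j = i] this holds because [q i] is in [U]; earlier balls already miss [C]. *)
  have far c : c \in C -> c \notin balls U -> c \notin ball (q j).
    move: ji; rewrite leq_eqVlt => /predU1P[-> _|ji cC1 _]; last by have [+ _] := rp_far st ji; apply.
    by apply: contraNN; rewrite /balls bigcup_seq => cq; apply/bigcupP; exists (q i).
  split=> [c /C'sub[cC1 cU]|k jk]; first exact: far.
  rewrite leq_eqVlt => /predU1P[->|ki]; first by rewrite q'S; exact: far.
  by rewrite q'E //; have [|_] := rp_far st (j := j); [exact: leq_trans jk ki | apply].
by rewrite q'S.
Qed.

(** The balls around [U] use at most 25 colours, so [C] has a vertex outside them, from which a
    clean way leads up to [A]. At least one gadget is present, so the end differs from [q 0]. *)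
Lemma rope_closing i q Q C S U : rope_prefix i.+1 25 q Q C S U ->
  exists p : seq G,
  [/\ forall h, ipath (chain Q h i.+1 ++ rcons p b0),
      q 0 \notin rcons p b0, {in p, forall w, ~~ q 0 -- w}
    & {subset p <= A :|: Y :|: B :|: D}].
Proof.
move=> st; have [CD cC nC] := rp_C st; have [sU5 siU] := rp_U st.
have [siD [c0 c0C sc0]] := rp_end st; have siS := rp_q st (leqnn i.+1).
have [y0S b0S q0D b0q0] := rp_in st.
set s := q i.+1 in siD sc0 siS siU.
have cBad : col 25 (balls U) by have := col_balls U; rewrite sU5.
have [x] := ncol_nonempty (ncolD (m := 0) cBad nC); rewrite inE => /andP[xU xC].
have xD := subsetP CD _ xC.
have [b bB xb] := upD xD; have [y yY yb] := upB bB; have [a aA ya] := upY yY.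
have [a0 a0A ya0] := upY y0Y.
have bx : b -- x by rewrite sedge_sym.
have bclean w : w \in S -> w != b /\ ~~ w -- b.
  by move=> wS; have [] := rp_clean st xC xU bB bx wS.
have yclean w : w \in S -> w != y /\ ~~ w -- y.
  by move=> wS; have [_] := rp_clean st xC xU bB bx wS; apply.
have neD z : z \in D -> (z != y0) * (z != b0).
  move=> zD; split; first by apply: contraTneq zD => ->; exact: disjYD.
  by apply: contraTneq b0B => <-; exact: disjDB.
(* Any induced path from [s] to [y0] in this set will do: apart from these two ends, the set is
   neither met by nor adjacent to the rest of [S] outside [y0]. *)
have cZ : connected (y0 |: ((y |: (b |: (s |: C))) :|: A)).
  apply: (connectedU1 (y := a0)) => //; last by rewrite inE a0A orbT.
  apply: (connectedU (x := y) (y := a)) => //; last by rewrite !inE eqxx.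
  apply: (connectedU1 (y := b)); rewrite ?inE ?eqxx // 1?sedge_sym //.
  apply: (connectedU1 (y := x)); rewrite ?inE ?xC ?orbT //.
  exact: connectedU1 sc0.
have [p [ip lp pZ]] : exists p, [/\ ipath (s :: p), last s p = y0 &
    {subset s :: p <= y0 |: ((y |: (b |: (s |: C))) :|: A)}].
  by apply: connected_ipath => //; rewrite !inE eqxx ?orbT.
have sp : s \notin p by case/andP: (ipath_uniq ip).
have pcases w : w \in p -> w = y0 \/ [\/ w = b, w = y, w \in C | w \in A].
  move=> wp; have ws : w != s by apply: contraNneq sp => <-.
  have := pZ w; rewrite inE wp orbT => /(_ isT); rewrite !inE (negPf ws) /=.
  case/or3P=> [/eqP|/or3P[/eqP|/eqP|]|]; [by left|right; by constructor 2|right; by constructor 1|right; by constructor 3|right; by constructor 4].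
have new w v : w \in S -> w != s -> w != y0 -> v \in p -> v != y0 -> w != v /\ ~~ w -- v.
  move=> wS ws wy0 /pcases[->|[->|->|vC|vA]]; rewrite ?eqxx // => _.
  - exact: bclean.
  - exact: yclean.
  - by have [? /(_ ws)] := rp_CS st wS vC.
  have [vY vB vD] := disjA vA.
  case: (rp_S st wS) => [e|wB|wD]; first by rewrite e eqxx in wy0.
    by split; [apply: contraNneq vB => <- | rewrite sedge_sym AB].
  by split; [apply: contraNneq vD => <- | rewrite sedge_sym AD].
have [_ b0s] := neD s siD; rewrite eq_sym in b0s.
have b0y0' := edge_neq b0y0.
have [sy0 sb0 sy0' sb0'] : [/\ s != y0, s != b0, ~~ s -- y0 & ~~ s -- b0].
  apply: (rp_front st (ltnSn i) (h := true)).
  have [_ ls _] := rp_seg st true (ltnSn i); have := mem_last (q i) (Q i true).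
  rewrite ls inE => /predU1P[e|//].
  have [_ /(_ i.+1 (ltnSn i) (leqnn _)) /negP[]] := rp_far st (ltnSn i).
  by rewrite e; apply: (in_ball (i := 0)); rewrite ?inE.
have iK : ipath (s :: rcons p b0).
  apply: ipath_rcons => //; rewrite lp 1?sedge_sym // => w.
  rewrite inE => /predU1P[->|wp] wy0; first by [].
  by have [] := new b0 w b0S b0s b0y0' wp wy0; rewrite eq_sym sedge_sym.
exists p; split.
- move=> h; have := rp_path st h; have := rope_mem_chain (h := h) st.
  have := rope_last h st.
  have chS : {in chain Q h i.+1, forall w, [/\ w != y0, w != b0, ~~ w -- y0 & ~~ w -- b0]}.
    by move=> w /mem_chain[j ji]; exact: (rp_front st ji).
  case: (chain Q h i.+1) chS => [|c1 l] chS.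
    move=> /= e; have [_ /(_ i.+1 (ltn0Sn i) (leqnn _)) /negP[]] := rp_far st (ltn0Sn i).
    by rewrite -e; apply: (in_ball (i := 0)); rewrite ?inE.
  move=> ls sub' ip0; rewrite /= in ls.
  have ip1 : ipath (c1 :: l) by apply: (@ipath_suffix [:: q 0]).
  have := ipath_uniq ip1.
  have: {subset c1 :: l <= S} by move=> w wl; apply: sub'; rewrite inE wl orbT.
  move: chS ip1 => {sub' ip0}.
  rewrite lastI ls -/s => chS ip1 sub ul.
  rewrite cat_rcons; apply: ipath_cat => // u v ul1.
  have uc : u \in rcons (belast c1 l) s by rewrite mem_rcons inE ul1 orbT.
  have [uy0 ub0 uy0' ub0'] := chS u uc.
  rewrite mem_rcons inE => /predU1P[->//|vp].
  have [->//|vy0] := eqVneq v y0.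
  apply: new => //; first exact: sub.
  by apply: contraTneq ul1 => ->; move: ul; rewrite rcons_uniq => /andP[].
- have [q0y0 q0b0] := neD _ q0D; rewrite mem_rcons inE (negPf q0b0) /=.
  apply/negP => q0p; have [] := new (q 0) (q 0) (rp_q st (leq0n _)) _ q0y0 q0p q0y0.
    apply/eqP => e; have [_ /(_ i.+1 (ltn0Sn i) (leqnn _)) /negP[]] := rp_far st (ltn0Sn i).
    by rewrite -/s -e; apply: (in_ball (i := 0)); rewrite ?inE.
  by rewrite eqxx.
- move=> w wp; have [->|wy0] := eqVneq w y0; first by rewrite sedge_sym YD.
  have [q0y0 q0b0] := neD _ q0D.
  have [] // := new (q 0) w (rp_q st (leq0n _)) _ q0y0 wp wy0.
  apply/eqP => e; have [_ /(_ i.+1 (ltn0Sn i) (leqnn _)) /negP[]] := rp_far st (ltn0Sn i).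
  by rewrite -/s -e; apply: (in_ball (i := 0)); rewrite ?inE.
move=> w /pcases[->|[->|->|wC|wA]]; rewrite !inE ?y0Y ?bB ?yY ?wA ?orbT //.
by rewrite (subsetP CD _ wC) !orbT.
Qed.

End Rope.

(** * From closed paths to induced cycles *)

Lemma path_vertices_cat x (p1 p2 : seq G) :
  path_vertices x (p1 ++ p2) = path_vertices x p1 :|: path_vertices (last x p1) p2.
Proof.
apply/setP => w; rewrite !inE mem_cat.
case: (w =P last x p1) => [->|_] /=; last by rewrite orbA.
by have := mem_last x p1; rewrite inE !orbA => ->.
Qed.

Lemma path_edges_cat x (p1 p2 : seq G) :
  path_edges x (p1 ++ p2) = path_edges x p1 :|: path_edges (last x p1) p2.
Proof.
have memE y (p : seq G) f : (f \in path_edges y p) =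
    has (fun uv => f == [set uv.1; uv.2]) (zip (y :: p) p).
  apply/imsetP/hasP => [[uv uvp ->]|[uv uvp /eqP->]]; by exists uv.
apply/setP => f; rewrite inE !memE.
by elim: p1 x => [|y p1 IH] x //=; rewrite IH orbA.
Qed.

Lemma path_zip x (p : seq G) uv : path E x p -> uv \in zip (x :: p) p ->
  [/\ uv.1 -- uv.2, uv.1 \in x :: p & uv.2 \in p].
Proof.
elim: p x => //= y p IH x /andP[xy pp].
rewrite inE => /predU1P[->|/(IH _ pp)[uv1 uv2 uv3]] /=; first by rewrite !mem_head.
by split=> //; rewrite inE ?uv2 ?uv3 orbT.
Qed.

Lemma zip_consecutive x (p l1 l2 : seq G) u v :
  x :: p = l1 ++ u :: v :: l2 -> (u, v) \in zip (x :: p) p.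
Proof.
elim: l1 x p => [|a l1 IH] x p /=; first by case=> -> ->; rewrite /= mem_head.
case=> _; case: p => [|y p]; first by case: l1 {IH}.
by move=> /IH; rewrite /= [in X in _ -> X]inE => ->; rewrite orbT.
Qed.

Lemma closed_path_edges x (R : seq G) : uniq (x :: R) ->
  path_edges x (rcons R x) = cycle_edges (x :: R).
Proof.
move=> uR; have szip : size (zip (x :: rcons R x) (rcons R x)) = (size R).+1.
  by rewrite size_zip /= size_rcons; apply/minn_idPr; rewrite leqnSn.
have nz i : i < (size R).+1 -> nth (x, x) (zip (x :: rcons R x) (rcons R x)) i =
    (nth x (x :: R) i, next (x :: R) (nth x (x :: R) i)).
  move=> iR; rewrite nth_zip_cond szip iR.
  have -> : nth x (x :: rcons R x) i = nth x (x :: R) i.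
    by rewrite -rcons_cons nth_rcons /= iR.
  rewrite next_nth mem_nth // index_uniq // nth_rcons.
  (* At the last index [next] wraps around to [x], which is also the default value of [nth]. *)
  congr (_, _); case: ltngtP => // [h|->]; last by rewrite nth_default.
  by rewrite ltnS leqNgt h in iR.
apply/setP => f; apply/imsetP/imsetP => [[uv /(nthP (x, x))[i]]|[u uc ->]].
  rewrite szip => iR; rewrite nz // => <- ->.
  by exists (nth x (x :: R) i) => //; exact: mem_nth.
exists (u, next (x :: R) u) => //; apply/(nthP (x, x)).
exists (index u (x :: R)); first by rewrite szip index_mem.
by rewrite nz ?index_mem ?nth_index.
Qed.

(** An edge among these vertices either joins [x] to [y] or [z], or joins consecutive vertices of
    the induced path by [ipath_adj]. *)
Lemma closed_induced_cycle x y z (M : seq G) :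
  ipath (y :: rcons M z) -> x \notin y :: rcons M z -> x -- y -> x -- z ->
  {in M, forall w, ~~ x -- w} ->
  let p := rcons (y :: rcons M z) x in
  induced_cycle (path_vertices x p) (path_edges x p).
Proof.
move=> iR xR xy xz xM p; pose R := y :: rcons M z.
have pp : path E x p.
  by rewrite /p rcons_path last_cons last_rcons sedge_sym xz andbT /= xy; exact: ipath_path.
have uR : uniq (x :: R) by rewrite cons_uniq xR; exact: ipath_uniq iR.
have pvE w : (w \in path_vertices x p) = (w \in x :: R).
  by rewrite inE /p in_cons mem_rcons !inE orbA orbb.
have eE : path_edges x p = cycle_edges (x :: R) by exact: closed_path_edges.
split.
  exists (x :: R); split=> //; last by apply/setP => w; rewrite pvE inE.
  by apply/and3P; split; rewrite //= size_rcons.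
apply/setP => f; apply/imsetP/idP => [[uv uvp ->]|].
  have [uv1 uv2 uv3] := path_zip pp uvp; rewrite inE; apply/andP; split.
    by apply/imsetP; exists uv; rewrite ?inE.
  apply/subsetP => w; rewrite in_set2 => /orP[] /eqP->; rewrite in_set //.
  by rewrite in_cons uv3 orbT.
rewrite inE => /andP[/imsetP[[u v]]]; rewrite inE /= => uv -> /subsetP sub.
have [uV vV] : u \in x :: R /\ v \in x :: R.
  by split; rewrite -pvE; apply: sub; rewrite !inE eqxx ?orbT.
have edge a b : (a, b) \in zip (x :: p) p ->
    exists2 ab, ab \in zip (x :: p) p & [set a; b] = [set ab.1; ab.2].
  by move=> abp; exists (a, b).
have xadj w : w \in R -> x -- w ->
    exists2 ab, ab \in zip (x :: p) p & [set x; w] = [set ab.1; ab.2].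
  rewrite inE mem_rcons inE => /or3P[/eqP->|/eqP->|/xM/negPf->//] _.
    by apply: edge; apply: (@zip_consecutive x p [::] (rcons (rcons M z) x)).
  rewrite setUC; apply: edge; apply: (@zip_consecutive x p (x :: y :: M) [::]).
  by rewrite /p -!cats1 /= -catA.
move: uV vV; rewrite !(in_cons x) => /predU1P[ux|uR'] /predU1P[vx|vR'].
- by rewrite ux vx sedge_irr in uv.
- by rewrite ux in uv *; exact: xadj.
- by rewrite vx in uv *; rewrite setUC; apply: xadj; rewrite // sedge_sym.
have [l1 [l2 [e|e]]] := ipath_adj iR uR' vR' uv.
  apply: edge; apply: (@zip_consecutive x p (x :: l1) (rcons l2 x)).
  by rewrite /p e -!cats1 -catA.
rewrite setUC; apply: edge; apply: (@zip_consecutive x p (x :: l1) (rcons l2 x)).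
by rewrite /p e -!cats1 -catA.
Qed.

(** * The initial levels and the iteration of gadgets *)

Definition need n := iter n (fun m => 4 * m + 66) 25.

(** [need] starts from the 25 of the closing and applies the cost of a gadget repeatedly. The extra
    1 pays for the neighbours of [b], and the doubling for the choice of a level. *)
Lemma rope_exists (X : {set G}) n :
  ~~ col (need n.+1 + 1 + (need n.+1 + 1)) X ->
  exists q Q (p : seq G) b,
  [/\ forall h, ipath (q 0 :: chain Q h n.+1) /\ ipath (chain Q h n.+1 ++ rcons p b),
      forall j h, j < n.+1 ->
        [/\ ipath (q j :: Q j h), last (q j) (Q j h) = q j.+1 & odd (size (Q j h)) = h],
      [/\ q 0 \notin rcons p b, {in p, forall w, ~~ q 0 -- w} & b -- q 0],
      forall j k, j < k -> k <= n.+1 -> q k \notin ball (q j)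
    & [/\ forall j h, j < n.+1 -> {subset Q j h <= X},
          forall j, j <= n.+1 -> q j \in X & {subset rcons p b <= X}]].
Proof.
move=> nX; have [X1 [/subsetP X1X cX1 nX1 _]] := ncol_component nX.
have [z zX] := ncol_nonempty nX1.
have [lev [levz lev0 levS lev_pred]] := bfs_levels cX1 zX.
have [k nk] := ncol_level levS nX1.
(* Levels up to 2 are stable, being contained in [walks k z]. So there is room for [B], [Y] and [A]
   above the chosen level. *)
have k3 : 2 < k.
  rewrite ltnNge; apply: contra nk => k2; apply: (col_leq (leq_addl _ _)).
  apply: col_sub (col_walks z (leq_trans k2 (isT : 2 <= 4))).
  apply/subsetP => x; rewrite inE => /andP[xX /eqP <-] {k k2}.
  move el: (lev x) => i; elim: i x xX el => [|i IH] x xX el.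
    by rewrite (lev0 x xX el) inE.
  have [|y [yX yx]] := lev_pred x xX; first by rewrite el.
  by rewrite el => -[ely]; apply: walksS (IH y yX (esym ely)) yx.
case: k k3 nk => [|[|[|k]]] // _ nk.
have [D [/subsetP DL cD nD _]] := ncol_component nk.
pose A := [set x in X1 | lev x <= k].
pose Y := [set x in X1 | lev x == k.+1].
pose B := [set x in X1 | lev x == k.+2].
have AP x : x \in A -> x \in X1 /\ lev x <= k by rewrite inE => /andP[].
have YP x : x \in Y -> x \in X1 /\ lev x = k.+1 by rewrite inE => /andP[? /eqP].
have BP x : x \in B -> x \in X1 /\ lev x = k.+2 by rewrite inE => /andP[? /eqP].
have DP x : x \in D -> x \in X1 /\ lev x = k.+3 by move=> /DL; rewrite inE => /andP[? /eqP].
have far x y : x \in X1 -> y \in X1 -> (lev x).+1 < lev y -> ~~ x -- y.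
  by move=> xX yX; apply: contraTN => /(levS x y xX yX); rewrite -leqNgt.
have AB : {in A & B, forall x y, ~~ x -- y}.
  by move=> x y /AP[xX lx] /BP[yX ly]; apply: far; rewrite ?ly.
have AD : {in A & D, forall x y, ~~ x -- y}.
  by move=> x y /AP[xX lx] /DP[yX ly]; apply: far; rewrite ?ly // !ltnS ltnW.
have YD : {in Y & D, forall x y, ~~ x -- y}.
  by move=> x y /YP[xX lx] /DP[yX ly]; apply: far; rewrite ?ly ?lx.
have disjA : {in A, forall x, [/\ x \notin Y, x \notin B & x \notin D]}.
  move=> x /AP[_ lx]; split; apply: contraTN lx;
    [move=> /YP[_ ->]|move=> /BP[_ ->]|move=> /DP[_ ->]]; rewrite -ltnNge //.
  by rewrite ltnS ltnW.
have disjYD : {in Y, forall x, x \notin D}.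
  by move=> x /YP[_ lx]; apply/negP => /DP[_]; rewrite lx => /eqP; rewrite !eqSS ltn_eqF.
have disjDB : {in D, forall x, x \notin B}.
  by move=> x /DP[_ lx]; apply/negP => /BP[_]; rewrite lx => /eqP; rewrite !eqSS gtn_eqF.
have up x i : x \in X1 -> lev x = i.+1 -> exists2 y, y \in X1 /\ lev y = i & x -- y.
  move=> xX lx; have [|y [yX yx]] := lev_pred x xX; first by rewrite lx.
  by rewrite lx => -[ly]; exists y; rewrite // sedge_sym.
have upY : {in Y, forall x, exists2 a, a \in A & x -- a}.
  move=> x /YP[xX lx]; have [y [yX ly] xy] := up _ _ xX lx.
  by exists y; rewrite // inE yX ly /=.
have upB : {in B, forall x, exists2 y, y \in Y & x -- y}.
  move=> x /BP[xX lx]; have [y [yX ly] xy] := up _ _ xX lx.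
  by exists y; rewrite // inE yX ly eqxx.
have upD : {in D, forall x, exists2 b, b \in B & x -- b}.
  move=> x /DP[xX lx]; have [y [yX ly] xy] := up _ _ xX lx.
  by exists y; rewrite // inE yX ly eqxx.
have cA : connected A.
  have zA : z \in A by rewrite inE zX levz.
  suff cz x : x \in A -> connect (within A) z x.
    by apply/connectedP => x y /cz xz /cz; apply: connect_trans; rewrite within_sym.
  move el: (lev x) => i; elim: i x el => [|i IH] x el xA; have [xX lx] := AP x xA.
    by rewrite (lev0 x xX el).
  have [y [yX ly] xy] := up _ _ xX el.
  have yA : y \in A by rewrite inE yX ly; move: lx; rewrite el => /ltnW.
  apply: connect_trans (IH y ly yA) _; apply: connect1.
  by rewrite /within yA xA sedge_sym.
have [d dD] := ncol_nonempty nD; have [b bB db] := upD d dD.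
have [y yY yb] := upB b bB.
have [C [CDN cC nC maxC]] := ncol_component (ncolD (col_neighbours b) nD).
have [c cC'] := ncol_nonempty nC.
(* With the neighbours of [b] removed, [b] sees nothing in [C], while by maximality a boundary
   vertex [s] of [C] is adjacent to [b]: it becomes [q 0]. *)
have CD : C \subset D by apply: subset_trans CDN (subsetDl _ _).
have CN : {in C, forall x, ~~ b -- x}.
  by move=> x /(subsetP CDN); rewrite !inE => /andP[].
have dC : d \notin C by apply/negP => /CN; rewrite sedge_sym db.
have [s [t [sD sC tC st]]] := connected_boundary cD CD cC' dD dC.
have bs : b -- s.
  by apply: contraNT sC => bs; apply: maxC tC st; rewrite !inE bs.
have disjS w : w \in D -> w != y /\ w != b.
  move=> wD; split; first by apply: contraTneq wD => ->; exact: disjYD.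
  by apply: contraTneq bB => <-; exact: disjDB.
(* The list [U] repeats [s] only to reach the size 5 fixed in [rope_prefix]. *)
have prefix0 : rope_prefix Y B D y b 0 (need n.+1) (fun=> s) (fun _ _ => [::]) C
    [set w in [:: y; b; s]] [:: y; b; s; s; s].
  split=> //=.
  - by rewrite !inE !eqxx !orbT.
  - by rewrite !inE !eqxx !orbT.
  - move=> w; rewrite in_set !in_cons in_nil orbF => /or3P[/eqP->|/eqP->|/eqP->]; [by constructor 1|by constructor 2|by constructor 3].
  - move=> w x; rewrite inE [w \in _]inE => wS xC; have xD := subsetP CD _ xC.
    have [xy xb] := disjS x xD; split.
      apply: contraTneq xC => <-; move: wS; rewrite !inE => /or3P[] /eqP->.
      + by apply/negP => /(subsetP CD) yD; have := disjYD y yY; rewrite yD.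
      + by apply/negP => /(subsetP CD) bD; have := disjDB b bD; rewrite bB.
      by [].
    move: wS; rewrite !inE => /or3P[] /eqP-> //; last by rewrite eqxx.
    + by move=> _; apply: YD.
    by move=> _; exact: CN.
  - by split=> //; exists t.
  - move=> x xC xU b' b'B b'x w; rewrite inE => wS.
    have wU : w \in [:: y; b; s; s; s] by move: wS; rewrite !inE => /or3P[] ->; rewrite ?orbT.
    have near i : i <= 4 -> x \notin walks i w.
      by move=> i4; apply: contraNN xU; exact: in_balls i4 wU.
    have ne i v : i <= 4 -> x \in walks i v -> w != v.
      by move=> i4; apply: contraTneq => <-; exact: near.
    split=> [|y' y'Y b'y'].
      split; first by apply: (ne 1) => //; exact: walks1.
      apply: contraNN (near 2 isT) => wb'; exact: walksS (walks1 wb') b'x.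
    rewrite sedge_sym in b'y'.
    split; first by apply: (ne 2) => //; exact: walksS (walks1 b'y') b'x.
    apply: contraNN (near 3 isT) => wy'; exact: walksS (walksS (walks1 wy') b'y') b'x.
  by rewrite !inE eqxx !orbT.
have iterate i j q Q C1 S1 U1 : rope_prefix Y B D y b i (need j) q Q C1 S1 U1 ->
    exists q Q C2 S2 U2, rope_prefix Y B D y b (i + j) 25 q Q C2 S2 U2.
  elim: j i q Q C1 S1 U1 => [|j IH] i q Q C1 S1 U1 st1.
    by rewrite addn0; exists q, Q, C1, S1, U1.
  have [q' [Q' [C2 [S2 [U2 st2]]]]] := rope_step YD disjYD disjDB yY bB st1.
  by rewrite addnS -addSn; exact: IH st2.
have [q [Q [C2 [S2 [U2 st2]]]]] := iterate _ _ _ _ _ _ _ prefix0.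
rewrite add0n in st2.
have [p [ip q0p pq0 pX]] := rope_closing cA AB AD YD disjA disjYD disjDB upY upB upD yY bB yb st2.
have SX : {subset S2 <= X}.
  move=> w wS; apply: X1X; case: (rp_S st2 wS) => [->|/BP[]//|/DP[]//].
  by case: (YP y yY).
have b0q0 : b -- q 0 by case: (rp_in st2).
exists q, Q, p, b; split=> //.
- by move=> h; split; [exact: rp_path st2 h | exact: ip].
- exact: rp_seg st2.
- by move=> j i ji ii; have [_ H] := rp_far st2 (leq_trans ji ii); exact: H.
split.
- by move=> j h jn w wQ; apply: SX; exact: (rp_sub st2 jn wQ).
- by move=> j jn; apply: SX; exact: (rp_q st2 jn).
move=> w; rewrite mem_rcons inE => /predU1P[->|/pX].
  by apply: X1X; case: (BP b bB).
by rewrite !in_setU -!orbA => /or4P[/AP|/YP|/BP|/DP] [wX _]; exact: X1X.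
Qed.

(** * Distances, the closed rope and the chromatic bound *)

Lemma far_distance x y : y \notin ball x -> distance_ge 5 x y.
Proof.
move=> yx p /and3P[pp /eqP lp _]; rewrite leqNgt; apply: contra yx => p5.
by apply: (in_ball (i := size p)) => //; apply/walksP; exists p.
Qed.

Lemma ball_sym x y : (x \in ball y) = (y \in ball x).
Proof.
by apply/idP/idP => /bigcupP[i _ /walks_sym xi]; apply/bigcupP; exists i.
Qed.

End OddGirth.

(** On the induced path [c ++ rcons p b], the vertex [x] sees only the head of [c] and the end [b],
    so [closed_induced_cycle] applies. *)
Lemma closing_cycle x (c p : seq G) b :
  ipath (x :: c) -> ipath (c ++ rcons p b) -> c != [::] ->
  x \notin rcons p b -> {in p, forall w, ~~ x -- w} -> b -- x ->
  let w := c ++ rcons (rcons p b) x in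
  [/\ path E x w, uniq w & induced_cycle (path_vertices x w) (path_edges x w)].
Proof.
case: c => // y c ixc ic _ xp px bx w.
have xc : x \notin y :: c by case/andP: (ipath_uniq ixc).
have [xy cx] : x -- y /\ {in c, forall v, ~~ x -- v}.
  by case/andP: ixc => _ /andP[-> /allP cx]; split=> // v /cx /andP[].
have wE : w = rcons (y :: rcons (c ++ p) b) x by rewrite /w -!rcons_cat.
rewrite cat_cons -rcons_cat in ic.
have xw : x \notin y :: rcons (c ++ p) b.
  by rewrite rcons_cat -cat_cons mem_cat negb_or xc.
split.
- by rewrite wE rcons_path /= last_rcons xy bx andbT; exact: ipath_path.
- by rewrite wE rcons_uniq xw; exact: ipath_uniq ic.
rewrite wE; apply: closed_induced_cycle => //; first by rewrite sedge_sym.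
by move=> v; rewrite mem_cat => /orP[/cx|/px].
Qed.

Lemma chi_leq (X : {set G}) m : 0 < m -> col m X -> chi (induced X) <= m.
Proof.
move=> m0 /colP[f [fm fp]]; rewrite /chi; case: ex_minnP => k _; apply.
case: m m0 fm => // m _ fm.
apply/existsP; exists [ffun x : induced X => inord (f (val x))].
apply/forallP => x; apply/forallP => y; apply/implyP => xy.
rewrite !ffunE -val_eqE /= !inordK ?fm ?(valP x) ?(valP y) //.
by apply: fp => //; [exact: valP x | exact: valP y].
Qed.

End Graph.

Theorem theorem4p6 (G : sgraph) (X : {set G})
    (odd_girth_G : odd_girth_ge G 11)
    (chi_X : 99525 <= chi (induced X)) :
  exists (q : 'I_5 -> G) (Q : 'I_5 -> bool -> seq G),
    [/\ arithmetic_rope 5 q Q,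
        forall i, q i \in X
      & forall i h, {subset Q i h <= X}].
Proof.
(* Five gadgets run from [q 0] to [q 5]; [q 5] becomes an inner vertex of the last segment, which
   continues back to [q 0]. *)
have [|q [Q [p [b [ip seg [q0p pq0 bq0] qfar [QX qX pX]]]]]] :=
  @rope_exists G odd_girth_G X 4.
  (* [need 5] is 48106, so [2 * 48107 = 96214] colours would suffice for [X], fewer than 99525. *)
  apply/negP => cX; have := leq_trans chi_X (chi_leq _ cX).
  by rewrite addn1 addSn => /(_ isT); apply/negP; vm_compute.
pose K := rcons (rcons p b) (q 0); pose o := odd (size K).
(* The path closing the cycle is appended to the last gadget, and may exchange
   the parities of its two paths. *)
pose Qn j h := if j < 4 then Q j h else Q 4 (h (+) o) ++ K.
have q_neq0 j : 0 < j -> j <= 5 -> q j != q 0.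
  move=> j0 j5; apply: contraNneq (qfar 0 j j0 j5) => ->.
  by apply: (in_ball (i := 0)); rewrite ?inE.
have lastQ j h : j < 5 -> last (q j) (Q j h) = q j.+1 by move=> /seg-/(_ h)[].
have lastQn j h : j < 4 -> last (q j) (Qn j h) = q j.+1.
  by move=> j4; rewrite /Qn j4 lastQ // ltnW.
have cyc H : let w := Qn 0 (H 0) ++ Qn 1 (H 1) ++ Qn 2 (H 2) ++ Qn 3 (H 3) ++ Qn 4 (H 4) in
    [/\ path (@sedge G) (q 0) w, uniq w
      & induced_cycle (path_vertices (q 0) w) (path_edges (q 0) w)].
  (* [H'] is the choice made inside the gadgets, with the parity exchange in the last one. *)
  pose H' j := if j < 4 then H j else H j (+) o.
  have [i1 i2] := ip H'; have c0 : chain Q H' 5 != [::].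
    apply: contraNneq (q_neq0 5 isT isT) => c0; have : last (q 0) (chain Q H' 5) = q 5.
      by rewrite /= !last_cat !lastQ.
    by rewrite c0 => /= ->.
  by have := closing_cycle i1 i2 c0 q0p pq0 bq0; rewrite /= -!catA.
exists (fun i => q (val i)), (fun i h => Qn (val i) h); split; first split.
- move=> [i i5] h /=; rewrite /Qn; case: ltnP => i4.
    have [ii li _] := seg i h i5; apply/and3P; split.
    + exact: ipath_path.
    + by rewrite li modn_small.
    exact: ipath_uniq.
  have -> : i = 4 by apply/eqP; rewrite eqn_leq i4 -ltnS i5.
  (* That the extended last path is simple follows from the distinctness of the vertices of the
     whole cycle; [q 4] lies in the part [c] before it. *)
  have [+ + _] := cyc (fun=> h); rewrite !catA -(catA _ (Q 4 _) K).
  set c := (X in X ++ _); set d := (X in c ++ X).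
  have lc : last (q 0) c = q 4 by rewrite /c !last_cat !lastQn.
  have qc : q 4 \in c.
    by have := mem_last (q 0) c; rewrite lc inE (negPf (q_neq0 4 _ _)).
  rewrite cat_path lc cat_uniq => /andP[_ pd] /and3P[_ /hasPn cd ud].
  apply/and3P; split=> //.
    by rewrite /d last_cat /K last_rcons.
  by rewrite cons_uniq ud andbT; apply/negP => /cd; rewrite qc.
- move=> i; have par h : odd (size (Qn i h)) = h.
    rewrite /Qn; case: ifP => _; first by case: (seg i h (ltn_ord i)).
    by rewrite size_cat oddD; case: (seg 4 (h (+) o) isT) => _ _ ->; rewrite addbK.
  by rewrite !par.
- move=> h; have [_ _] := cyc (fun j => h (inord j)).
  rewrite 4!path_vertices_cat 4!path_edges_cat !lastQn //.
  have big (T : finType) (F : nat -> bool -> {set T}) :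
      \bigcup_(i < 5) F i (h i) = F 0 (h (inord 0)) :|: (F 1 (h (inord 1)) :|:
        (F 2 (h (inord 2)) :|: (F 3 (h (inord 3)) :|: F 4 (h (inord 4))))).
    rewrite (eq_bigr (fun i : 'I_5 => F i (h (inord i)))) => [|i _]; last by rewrite inord_val.
    by rewrite -(big_mkord xpredT (fun i => F i (h (inord i)))) /index_iota /= !big_cons big_nil setU0.
  rewrite (big _ (fun i b => path_vertices (q i) (Qn i b))).
  by rewrite (big _ (fun i b => path_edges (q i) (Qn i b))).
- move=> i j; wlog ij : i j / i < j.
    move=> H nij; have [ij|ji|e] := ltngtP i j; first exact: H.
      by apply: far_distance; rewrite ball_sym; apply: qfar => //; exact: ltnW (ltn_ord i).
    by rewrite (val_inj e) eqxx in nij.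
  by move=> _; apply: far_distance; apply: qfar => //; exact: ltnW (ltn_ord j).
- by move=> i; apply: qX; exact: ltnW (ltn_ord i).
move=> i h w; rewrite /Qn; case: ifP => _; first exact: QX (ltn_ord i) w.
rewrite mem_cat => /orP[|]; first exact: (@QX 4 _ isT).
by rewrite mem_rcons inE => /predU1P[->|/pX//]; exact: qX.
Qed.
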